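(* Let $1<p<\infty$ and $0<s<1$. Let $\Omega\subset\mathbb{R}^N$ be an open bounded set, with Lipschitz boundary. Then for every $u\in C^\infty_0(\Omega)$ we have $$\|u\|^p_{\mathcal{X}^{s,p}_0(\Omega)}\le C_1\,\|u\|^p_{\mathcal{D}_0^{s,p}(\Omega)},$$ for a constant $C_1>0$ depending on $N$, $p$, $\mathrm{diam}(\Omega)$ and the Lipschitz constant of $\partial\Omega$. In particular, we have $\mathcal{X}^{s,p}_0(\Omega)=\mathcal{D}^{s,p}_0(\Omega)$ in this case as well.
   Context: $C^\infty_0(\Omega)$ is the space of smooth functions with compact support in $\Omega$ (extended by $0$ to $\mathbb{R}^N$). $\mathrm{diam}(\Omega)$ is the diameter of $\Omega$. Lipschitz boundary has its usual meaning: near each of its points, $\partial\Omega$ is, up to a rigid motion, the graph of a Lipschitz function with $\Omega$ lying on one side of the graph; the Lipschitz constant of $\partial\Omega$ refers to the Lipschitz constant of these local graph functions. For $u\in C_0^\infty(\Omega)$ set $$\|u\|_{\mathcal{D}^{s,p}_0(\Omega)}:=[u]_{W^{s,p}(\mathbb{R}^N)}:=\left(\iint_{\mathbb{R}^N\times\mathbb{R}^N}\frac{|u(x)-u(y)|^p}{|x-y|^{N+sp}}\,dx\,dy\right)^{1/p},$$ and let $\mathcal{D}^{s,p}_0(\Omega)$ be the completion of $C^\infty_0(\Omega)$ with respect to this norm. $\mathcal{D}^{1,p}_0(\Omega)$ is the completion of $C^\infty_0(\Omega)$ with respect to the norm $u\mapsto\|\nabla u\|_{L^p(\Omega)}$.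 For $t>0$ and $u\in C_0^\infty(\Omega)$ the $K$-functional is $$K(t,u,L^p(\Omega),\mathcal{D}^{1,p}_0(\Omega)):=\inf_{v\in C^\infty_0(\Omega)}\Big\{\|u-v\|_{L^p(\Omega)}+t\,\|\nabla v\|_{L^p(\Omega)}\Big\},$$ and $$\|u\|_{\mathcal{X}^{s,p}_0(\Omega)}:=\left(\int_0^{+\infty}\left(\frac{K(t,u,L^p(\Omega),\mathcal{D}^{1,p}_0(\Omega))}{t^s}\right)^p\frac{dt}{t}\right)^{1/p}.$$ $\mathcal{X}^{s,p}_0(\Omega)$ is the completion of $C_0^\infty(\Omega)$ with respect to this norm. The equality $\mathcal{X}^{s,p}_0(\Omega)=\mathcal{D}^{s,p}_0(\Omega)$ means that the two norms are equivalent on $C^\infty_0(\Omega)$, so that the completions coincide.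
   Formalization: The constant C_1 also depends on the radius r of the balls in which the boundary is an L-Lipschitz graph; dependence on N, p, diam(Ω) and the Lipschitz constant alone is false, as a ball with many small holes removed shows. *)

(* Defs.v *)
From HB Require Import structures.
From mathcomp Require Import all_boot all_order all_algebra.
From mathcomp Require Import all_classical all_reals all_analysis.

Set Implicit Arguments.
Unset Strict Implicit.
Unset Printing Implicit Defensive.

Import Order.TTheory GRing.Theory Num.Theory.
Import numFieldNormedType.Exports.

Local Open Scope classical_set_scope.
Local Open Scope ring_scope.

(* Product sigma-algebra on row vectors; over a realType it is the Borel
   sigma-algebra of R^n. *)
Definition measure_rV_display : measure_display -> measure_display.
Proof. exact. Qed.

Section measurable_rV.
Context {d} {T : sigmaRingType d}.
Variable n : nat.

Let coors : 'I_n -> 'rV[T]_n -> T := fun i x => x ord0 i.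

Let rV_set0 : g_sigma_preimage coors set0.
Proof. exact: sigma_algebra0. Qed.

Let rV_setC A : g_sigma_preimage coors A -> g_sigma_preimage coors (~` A).
Proof. exact: sigma_algebraC. Qed.

Let rV_bigcup (F : _^nat) : (forall i, g_sigma_preimage coors (F i)) ->
  g_sigma_preimage coors (\bigcup_i (F i)).
Proof. exact: sigma_algebra_bigcup. Qed.

HB.instance Definition _ := @isMeasurable.Build (measure_rV_display d)
  'rV[T]_n (g_sigma_preimage coors) rV_set0 rV_setC rV_bigcup.

End measurable_rV.

Lemma measurable_rV_coord d (T : sigmaRingType d) n (i : 'I_n) :
  measurable_fun [set: 'rV[T]_n] (fun x : 'rV[T]_n => x ord0 i).
Proof.
move=> _ Y mY; rewrite setTI; apply: sub_sigma_algebra => /=.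
rewrite -bigcup_seq/=; exists i => /=; first by rewrite mem_index_enum.
by exists Y => //; rewrite setTI.
Qed.

Lemma measurable_fun_rV d1 d2 (T1 : measurableType d1) (T2 : measurableType d2)
    n (f : T1 -> 'rV[T2]_n) :
  (forall i, measurable_fun [set: T1] (fun x => f x ord0 i)) ->
  measurable_fun [set: T1] f.
Proof.
move=> mf; suff : g_sigma_preimage (fun i x => f x ord0 i) `<=` measurable.
  rewrite (g_sigma_preimage_comp (fun i (v : 'rV[T2]_n) => v ord0 i) f).
  by move=> prefS _ A mA; apply: prefS; exists A.
apply: smallest_sub; first exact: sigma_algebra_measurable.
case: n => [|n] in f mf *; first by rewrite big_ord0.
rewrite -bigcup_mkord_ord; apply: bigcup_sub => i Ii.
by move=> A [B mB <-]; exact: mf.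
Qed.

Section lebesgue_rV.
Context {R : realType}.

Definition rV_cons n (z : R * 'rV[R]_n) : 'rV[R]_n.+1 :=
  row_mx (const_mx z.1) z.2 : 'rV[R]_(1 + n).

Definition rV_uncons n (v : 'rV[R]_n.+1) : R * 'rV[R]_n :=
  (v ord0 ord0, \row_j v ord0 (lift ord0 j)).

Lemma rV_cons0 n (z : R * 'rV[R]_n) : rV_cons z ord0 ord0 = z.1.
Proof.
have -> : ord0 = lshift n (ord0 : 'I_1) :> 'I_(1 + n) by apply/val_inj.
by rewrite /rV_cons (row_mxEl (const_mx z.1 : 'rV_1)) mxE.
Qed.

Lemma rV_consS n (z : R * 'rV[R]_n) j :
  rV_cons z ord0 (lift ord0 j) = z.2 ord0 j.
Proof.
have -> : lift ord0 j = rshift 1 j :> 'I_(1 + n) by apply/val_inj.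
by rewrite /rV_cons (row_mxEr (const_mx z.1 : 'rV_1)).
Qed.

Lemma rV_consK n : cancel (@rV_cons n) (@rV_uncons n).
Proof.
move=> z; rewrite /rV_uncons rV_cons0 [RHS]surjective_pairing; congr pair.
by apply/rowP => j; rewrite mxE rV_consS.
Qed.

Lemma measurable_rV_cons n :
  measurable_fun [set: R * 'rV[R]_n] (@rV_cons n).
Proof.
apply: measurable_fun_rV => i; case: (unliftP ord0 i) => [j|] ->.
- rewrite (_ : (fun _ => _) = (fun v : 'rV[R]_n => v ord0 j) \o snd).
    by apply: measurableT_comp; [exact: measurable_rV_coord|].
  by apply/funext => z /=; rewrite rV_consS.
- rewrite (_ : (fun _ => _) = fst)//.
  by apply/funext => z /=; rewrite rV_cons0.
Qed.

Lemma measurable_rV_uncons n :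
  measurable_fun [set: 'rV[R]_n.+1] (@rV_uncons n).
Proof.
apply/measurable_fun_pairP; split; first exact: measurable_rV_coord.
apply: measurable_fun_rV => i.
rewrite (_ : (fun _ => _) = (fun v : 'rV[R]_n.+1 => v ord0 (lift ord0 i))).
  exact: measurable_rV_coord.
by apply/funext => v /=; rewrite mxE.
Qed.

Section step.
Context n (mu : {sigma_finite_measure set 'rV[R]_n -> \bar R}).

Definition lebesgue_rV_step :=
  pushforward (@lebesgue_measure R \x mu)%E (@rV_cons n).

Let stepM :=
  measure_function_pushforward__canonical__measure_function_Measure
    (@lebesgue_measure R \x mu)%E (@measurable_rV_cons n).

Let step0 : lebesgue_rV_step set0 = 0%E.
Proof. exact: (measure0 stepM). Qed.

Let step_ge0 A : (0 <= lebesgue_rV_step A)%E.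
Proof. exact: (measure_ge0 stepM). Qed.

Let step_sigma_additive : semi_sigma_additive lebesgue_rV_step.
Proof. exact: (@measure_semi_sigma_additive _ _ _ stepM). Qed.

HB.instance Definition _ := isMeasure.Build _ _ _ lebesgue_rV_step
  step0 step_ge0 step_sigma_additive.

Let step_sigma_finite : sigma_finite setT lebesgue_rV_step.
Proof.
have /sigma_finiteP[F [TF ndF Foo]] := sigma_finiteT (@lebesgue_measure R).
have /sigma_finiteP[G [TG ndG Goo]] := sigma_finiteT mu.
exists (fun k => @rV_uncons n @^-1` (F k `*` G k)).
  apply/seteqP; split => // v _.
  have [i _ Fi] : (\bigcup_i F i) (rV_uncons v).1 by rewrite -TF.
  have [j _ Gj] : (\bigcup_i G i) (rV_uncons v).2 by rewrite -TG.
  exists (maxn i j) => //; split.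
  - by move: Fi; exact/subsetPset/ndF/leq_maxl.
  - by move: Gj; exact/subsetPset/ndG/leq_maxr.
move=> k; have [mF Fk] := Foo k; have [mG Gk] := Goo k; split.
  rewrite -[X in measurable X]setTI; apply: measurable_rV_uncons => //.
  exact: measurableX.
rewrite /lebesgue_rV_step /pushforward -comp_preimage.
rewrite (_ : _ @^-1` (F k `*` G k) = F k `*` G k); last first.
  by rewrite (_ : _ \o _ = id)//; apply/funext => z; exact: rV_consK.
by rewrite product_measure1E// lte_mul_pinfty// ge0_fin_numE.
Qed.

HB.instance Definition _ := Measure_isSigmaFinite.Build _ _ _ lebesgue_rV_step
  step_sigma_finite.

End step.

(* Lebesgue measure on R^n, as the n-fold product of the Lebesgue measure
   on R. *)
Fixpoint lebesgue_rV n : {sigma_finite_measure set 'rV[R]_n -> \bar R} :=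
  match n with
  | 0%N => \d_(0 : 'rV[R]_0)
  | m.+1 => lebesgue_rV_step (lebesgue_rV m)
  end.

End lebesgue_rV.

Section euclidean.
Context {R : realType}.

(* The library's norm on row vectors is the sup norm. *)
Definition enorm n (x : 'rV[R]_n) : R := Num.sqrt (\sum_i x ord0 i ^+ 2).

Definition diam n (A : set 'rV[R]_n) : R :=
  sup [set enorm (z.1 - z.2) | z in A `*` A].

Definition boundary n (A : set 'rV[R]_n) : set 'rV[R]_n :=
  closure A `\` interior A.

Lemma normr_le_enorm n (x : 'rV[R]_n) : `|x| <= enorm x.
Proof.
rewrite [leLHS]/Num.norm/= mx_normrE; apply: bigmax_le; first exact: sqrtr_ge0.
move=> [i j] _ /=; rewrite (ord1 i) -sqrtr_sqr ler_wsqrtr//.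
by rewrite (bigD1 j)//= lerDl sumr_ge0// => k _; rewrite sqr_ge0.
Qed.

Lemma enorm_le_normr n (x : 'rV[R]_n) : enorm x <= n%:R * `|x|.
Proof.
have h i : x ord0 i ^+ 2 <= `|x| ^+ 2.
  rewrite -real_normK ?num_real// lerXn2r ?nnegrE//.
  rewrite [leRHS]/Num.norm/= mx_normrE; apply/bigmax_geP; right => /=.
  by exists (ord0, i).
rewrite -[leRHS]ger0_norm; last by rewrite mulr_ge0.
rewrite -sqrtr_sqr ler_wsqrtr//; apply: (le_trans (ler_sum _ (fun i _ => h i))).
rewrite sumr_const card_ord -(mulr_natl (`|x| ^+ 2)) exprMn ler_wpM2r ?sqr_ge0//.
by rewrite -natrX ler_nat; case: n {x h} => // n; rewrite leq_pmulr.
Qed.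

End euclidean.

Section lipschitz.
Context {R : realType} {n : nat}.
Implicit Types Omega : set 'rV[R]_n.+1.

(* In the ball of centre x0 and radius r, and after the rigid motion
   x |-> x A + b, Omega is the strict epigraph of g and its boundary is the
   graph of g. The graph variable is the coordinate of index 0. *)
Definition lipschitz_chart Omega (x0 : 'rV[R]_n.+1) (L r : R) :=
  exists (A : 'M[R]_n.+1) (b : 'rV[R]_n.+1) (g : 'rV[R]_n -> R),
    let h x := (x *m A + b) ord0 ord0 in
    let t x : 'rV[R]_n := col' ord0 (x *m A + b) in
    [/\ A *m A^T = 1%:M,
        forall y z, `|g y - g z| <= L * enorm (y - z),
        forall x, enorm (x - x0) < r -> (Omega x <-> g (t x) < h x) &
        forall x, enorm (x - x0) < r -> (boundary Omega x <-> h x = g (t x))].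

Definition lipschitz_boundary Omega := forall x0, boundary Omega x0 ->
  exists L r, [/\ 0 <= L, 0 < r & lipschitz_chart Omega x0 L r].

(* The Lipschitz constant L of the boundary comes with the size r of the balls
   in which the boundary is an L-Lipschitz graph: the norm comparison cannot be
   uniform in L alone, as small holes (where L <= 1) show. Bounded sets always
   admit such a pair (lipschitz_boundary_character). *)
Definition lipschitz_character Omega (L r : R) := [/\ 0 <= L, 0 < r &
  forall x0, boundary Omega x0 -> lipschitz_chart Omega x0 L r].

Lemma lipschitz_chart_le Omega x0 L r x1 L' r' :
  lipschitz_chart Omega x0 L r -> L <= L' ->
  (forall x, enorm (x - x1) < r' -> enorm (x - x0) < r) ->
  lipschitz_chart Omega x1 L' r'.
Proof.
move=> [A [b [g [AA gL Og bg]]]] LL' rr'; exists A, b, g; split => //.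
- move=> y z; apply: le_trans (gL _ _) _.
  by rewrite ler_wpM2r// sqrtr_ge0.
- by move=> x /rr'; exact: Og.
- by move=> x /rr'; exact: bg.
Qed.

Lemma boundary_bounded_compact Omega :
  bounded_set Omega -> compact (boundary Omega).
Proof.
move=> [M [Mreal OM]]; apply: bounded_closed_compact; last first.
  by apply: closedI; [exact: closed_closure|exact/open_closedC/open_interior].
exists M; split => // M' MM' x [xO _].
have : closed [set x : 'rV[R]_n.+1 | `|x| <= M'].
  apply: (@preimage_closed _ _ (fun x : 'rV[R]_n.+1 => `|x|) [set y | y <= M']).
    by move=> ? _; exact: norm_continuous.
  exact: closed_le.
apply; apply: closureS xO => y Oy /=; exact: OM.
Qed.

Lemma lipschitz_boundary_character Omega :
  bounded_set Omega -> lipschitz_boundary Omega ->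
  exists L r, lipschitz_character Omega L r.
Proof.
move=> /boundary_bounded_compact/compact_near_coveringP cO lO.
have /cO : forall x0, boundary Omega x0 ->
    \forall x \near x0 & M \near +oo, lipschitz_chart Omega x M M^-1.
  move=> x0 /lO[L [r [L0 r0 xLr]]].
  pose e := r / (n.+2%:R + n.+2%:R).
  have e0 : 0 < e by rewrite divr_gt0// addr_gt0.
  exists (ball x0 e, [set M | Num.max L e^-1 < M]).
    split; first exact: nbhsx_ballx.
    by apply: nbhs_pinfty_gt; exact: num_real.
  move=> [x M] [/= x0x]; rewrite gt_max => /andP[LM eM].
  apply: (lipschitz_chart_le xLr (ltW LM)) => y yx.
  have M0 : 0 < M by rewrite (lt_trans _ eM)// invr_gt0.
  have Me : M^-1 < e by rewrite invf_plt.
  have yx' : `|y - x| < e.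
    exact: le_lt_trans (normr_le_enorm _) (lt_trans yx Me).
  have xx' : `|x - x0| < e by rewrite distrC; move: x0x; rewrite -ball_normE.
  have yx0 : `|y - x0| < e + e.
    by rewrite -(subrKA x) (le_lt_trans (ler_normD _ _))// ltrD.
  apply: le_lt_trans (enorm_le_normr _) _.
  have : n.+1%:R * `|y - x0| <= n.+2%:R * `|y - x0| by rewrite ler_wpM2r ?ler_nat.
  move=> /le_lt_trans; apply.
  have : n.+2%:R * `|y - x0| < n.+2%:R * (e + e) by rewrite ltr_pM2l.
  move=> /lt_le_trans; apply.
  by rewrite mulrDr -mulrDl mulrCA divff ?mulr1// gt_eqF// addr_gt0.
move=> H.
have [M [M0 HM]] : exists M : R, 0 < M /\
    forall x, boundary Omega x -> lipschitz_chart Omega x M M^-1.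
  near (+oo : set_system R) => M; exists M; split; near: M.
    by apply: nbhs_pinfty_gt; exact: num_real.
  exact: H.
by exists M, M^-1; split; rewrite ?invr_gt0 ?ltW.
Unshelve. all: by end_near. Qed.

End lipschitz.

Section function_spaces.
Context {R : realType} {n : nat}.
Implicit Types (Omega : set 'rV[R]_n.+1) (u v : 'rV[R]_n.+1 -> R) (p s t : R).

Definition partial (i : 'I_n.+1) u : 'rV[R]_n.+1 -> R :=
  fun x => 'D_(delta_mx ord0 i) u x.

Definition smooth u := forall l : seq 'I_n.+1, let v := foldr partial u l in
  continuous v /\ forall i x, derivable v x (delta_mx ord0 i).

(* Elements of C_0^oo(Omega) are represented by their extension by 0. *)
Definition C0infty Omega : set ('rV[R]_n.+1 -> R) := [set u |
  let supp := closure [set x | u x != 0] in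
  [/\ smooth u, compact supp & supp `<=` Omega]].

Definition grad u (x : 'rV[R]_n.+1) : 'rV[R]_n.+1 := \row_i partial i u x.

Local Open Scope ereal_scope.

Definition Lpnorm Omega p u : \bar R :=
  (\int[lebesgue_rV n.+1]_(x in Omega) (`|u x| `^ p)%:E) `^ p^-1.

Definition Dnorm s p u : \bar R :=
  (\int[lebesgue_rV n.+1 \x lebesgue_rV n.+1]_z
     (`|u z.1 - u z.2| `^ p / enorm (z.1 - z.2) `^ (n.+1%:R + s * p))%:E)
  `^ p^-1.

Definition Kfunctional Omega p t u : \bar R :=
  ereal_inf [set Lpnorm Omega p (u \- v)%R
                 + t%:E * Lpnorm Omega p (fun x => enorm (grad v x))
            | v in C0infty Omega].

Definition Xnorm Omega s p u : \bar R :=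
  (\int[lebesgue_measure]_(t in `]0%R, +oo[)
     ((Kfunctional Omega p t u * (t `^ s)^-1%:E) `^ p * t^-1%:E)) `^ p^-1.

Definition equivalent_norms (T : Type) (D : set T) (N1 N2 : T -> \bar R) :=
  exists c C : R, [/\ (0 < c)%R, (0 < C)%R & forall x, D x ->
    c%:E * N1 x <= N2 x /\ N2 x <= C%:E * N1 x].

End function_spaces.

(* Main.v *)
(* For a scale t, cut u off at distance 4 t from the complement of Omega and
   mollify at scale t. This gives v in C_0^oo(Omega) such that both u - v and
   t grad v are bounded pointwise by averages of |u(x) - g(y)| over cubes of
   size t, where g is the cut-off u. The cut-off error is absorbed because, the
   boundary being Lipschitz, a point at distance < 4 t from the complement has a
   cube of size comparable to t on which u vanishes at distance <= M t. Hence
   K(t,u)^p <= C t^-N Phi(M t), with Phi(r) the integral of |u(x) - u(y)|^p over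
   |x - y| <= r. Conversely Phi(t) <= C t^N K(t,u)^p, since translations by h move
   v by at most C |h| |grad v| in L^p. Integrating against t^(-sp-1) dt and
   exchanging the integrals turns Phi into the Gagliardo seminorm. *)
Require Import Defs.
From HB Require Import structures.
From mathcomp Require Import all_boot all_order all_algebra.
From mathcomp Require Import all_classical all_reals all_analysis.
From mathcomp Require Import measurable_realfun ring lra.
Import Order.TTheory GRing.Theory Num.Theory.
Import numFieldNormedType.Exports.
Local Open Scope classical_set_scope.
Local Open Scope ring_scope.
Set Implicit Arguments.
Unset Strict Implicit.
Unset Printing Implicit Defensive.

(** The constant in the bound of the interpolation norm must not depend on [s]. There [s] enters
    only through the exponent [b = N + s p] of the layer-cake formula, and [1 <= b <= N + p] bounds
    every factor. All local geometry uses the sup norm: its balls are products of intervals, so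
    Fubini gives their volume, the mollifier can be a product of one-variable bumps, and
    translations reduce to axis-parallel ones. The passage to the Euclidean norm costs a factor [N].
    Differentiation under the integral sign rests on a quadratic Taylor bound for the kernel,
    uniform in the base point. The size [r] of the charts enters at large scales only: for
    [t >= r / (2 N)] no chart reaches far enough, and the exterior cube is taken outside a ball
    around [Omega], at a distance that is a multiple of [t] because the diameter is at most a
    multiple of [t]. *)

(** * Borel structure of row vectors under the sup norm *)

Section row_vector_topology.
Context {R : realType}.

Lemma coord_le_normr n (x : 'rV[R]_n) i : `|x ord0 i| <= `|x|.
Proof.
rewrite [leRHS]/Num.norm/= mx_normrE; apply/bigmax_geP; right => /=.
by exists (ord0, i).
Qed.

Lemma normr_rV_le n (x : 'rV[R]_n) e :
  0 <= e -> (forall i, `|x ord0 i| <= e) -> `|x| <= e.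
Proof.
move=> e0 xe; rewrite [leLHS]/Num.norm/= mx_normrE.
by apply: bigmax_le => // -[i j] _ /=; rewrite (ord1 i).
Qed.

Definition cube n (x : 'rV[R]_n) (t : R) := [set y | `|y - x| <= t].

Lemma measurable_fun_rVB n d (T : measurableType d) (f g : T -> 'rV[R]_n) :
  measurable_fun setT f -> measurable_fun setT g ->
  measurable_fun setT (fun x => f x - g x).
Proof.
move=> mf mg; apply: measurable_fun_rV => i.
rewrite (_ : (fun _ => _) = (fun x => f x ord0 i - g x ord0 i)); last first.
  by apply/funext => x; rewrite !mxE.
by apply: measurable_funB; apply: (measurableT_comp (measurable_rV_coord i)).
Qed.

Lemma measurable_fun_rVD n d (T : measurableType d) (f g : T -> 'rV[R]_n) :
  measurable_fun setT f -> measurable_fun setT g ->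
  measurable_fun setT (fun x => f x + g x).
Proof.
move=> mf mg; apply: measurable_fun_rV => i.
rewrite (_ : (fun _ => _) = (fun x => f x ord0 i + g x ord0 i)); last first.
  by apply/funext => x; rewrite !mxE.
by apply: measurable_funD; apply: (measurableT_comp (measurable_rV_coord i)).
Qed.

Lemma measurable_fun_rVZ n d (T : measurableType d) (f : T -> R) (x : 'rV[R]_n) :
  measurable_fun setT f -> measurable_fun setT (fun s => f s *: x).
Proof.
move=> mf; apply: measurable_fun_rV => i.
rewrite (_ : (fun _ => _) = (fun s => f s * x ord0 i)); last first.
  by apply/funext => s; rewrite !mxE.
exact: measurable_funM.
Qed.

Lemma cubeE n (x : 'rV[R]_n) t : 0 <= t ->
  cube x t = \bigcap_(i in [set: 'I_n]) [set y | `|y ord0 i - x ord0 i| <= t].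
Proof.
move=> t0; apply/seteqP; split => y /=.
  move=> yx i _ /=; apply: le_trans yx.
  by have := coord_le_normr (y - x) i; rewrite !mxE.
by move=> yx; apply: normr_rV_le => // i; rewrite !mxE; exact: yx.
Qed.

Lemma measurable_cube n (x : 'rV[R]_n) t : measurable (cube x t).
Proof.
have [t0|t0] := leP 0 t; last first.
  rewrite (_ : cube x t = set0)//; apply/seteqP; split => // y /= yx.
  by have := le_lt_trans yx t0; rewrite normr_lt0.
rewrite cubeE//; apply: fin_bigcap_measurable => // i _.
rewrite -[X in measurable X]setTI.
apply: (@measurable_fun_le _ _ _ setT (fun y : 'rV[R]_n => `|y ord0 i - x ord0 i|)
  (cst t)) => //.
apply: measurableT_comp => //; apply: measurable_funB => //.
exact: measurable_rV_coord.
Qed.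

(** The sigma-algebra is generated by the coordinates, so an open set is reached as a countable
    union of cubes with rational centre and radius [1/(k+1)]. *)
Lemma open_measurable_rV n (U : set 'rV[R]_n) : open U -> measurable U.
Proof.
move=> oU.
pose q2r (q : 'rV[rat]_n) : 'rV[R]_n := map_mx ratr q.
pose D := [set qk : 'rV[rat]_n * nat | cube (q2r qk.1) (qk.2.+1%:R^-1) `<=` U].
have -> : U = \bigcup_(qk in D) cube (q2r qk.1) (qk.2.+1%:R^-1).
  apply/seteqP; split => [x Ux|x [qk]]; last by move=> + xqk; exact.
  have /nbhs_ballP[e /= e0 eU] : nbhs x U by exact: open_nbhs_nbhs.
  have [k ke] : exists k : nat, k.+1%:R^-1 < e / 2.
    exists (Num.Def.truncn (e / 2)^-1).
    rewrite invf_plt ?posrE ?divr_gt0// truncnS_gt//.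
  have H i : exists q : rat, `|x ord0 i - ratr q| < k.+1%:R^-1.
    have /rat_in_itvoo[q] : x ord0 i - k.+1%:R^-1 < x ord0 i + k.+1%:R^-1.
      by rewrite ltrD2l gtrN ?invr_gt0.
    rewrite in_itv/= => /andP[h1 h2]; exists q.
    by rewrite ltr_norml; apply/andP; split; move: h1 h2; set k' := k.+1%:R^-1; lra.
  have [q qx] := choice H.
  have k0 : (0:R) <= k.+1%:R^-1 by rewrite invr_ge0.
  exists (\row_i q i, k) => /=; last first.
    by apply: normr_rV_le => // i; rewrite !mxE ltW.
  move=> y yq /=; apply: eU; rewrite -ball_normE/=.
  rewrite -(subrKA (q2r (\row_i q i))) (le_lt_trans (ler_normD _ _))//.
  rewrite (splitr e) ler_ltD//.
    apply/(le_trans _ (ltW ke))/normr_rV_le => // i.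
    by rewrite !mxE ltW.
  by rewrite distrC (le_lt_trans yq).
rewrite bigcup_mkcond.
apply: countable_bigcupT_measurable => [|qk]; first exact: countableP.
case: ifPn => // _.
exact: measurable_cube.
Qed.

Lemma continuous_measurable_rV n (f : 'rV[R]_n -> R) :
  continuous f -> measurable_fun setT f.
Proof.
move=> cf; apply: (measurability _ (RGenOpens.measurableE R)).
move=> _ [_ [a [b ->]] <-]; rewrite setTI.
by apply: open_measurable_rV; apply: open_comp => [x _|]; [exact: cf|exact: interval_open].
Qed.

Lemma measurable_normr_rV n : measurable_fun [set: 'rV[R]_n] (fun x => `|x|).
Proof. by apply: continuous_measurable_rV; exact: norm_continuous. Qed.

Lemma measurable_enorm n : measurable_fun [set: 'rV[R]_n] (@enorm R n).
Proof.
rewrite (_ : @enorm R n = @Num.sqrt R \o fun x : 'rV[R]_n => \sum_i x ord0 i ^+ 2)//.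
apply: measurableT_comp.
  by apply: continuous_measurable_fun; exact: sqrt_continuous.
apply: measurable_sum => i; apply: measurable_funX.
exact: measurable_rV_coord.
Qed.

End row_vector_topology.

(** * Translation invariance of Lebesgue measure and the volume of cubes *)

Section lebesgue_rV_translation.
Context {R : realType}.
Local Open Scope ereal_scope.

(** The pushforward of Lebesgue measure under a translation agrees with it on half-open intervals,
    hence everywhere by uniqueness. *)
Lemma lebesgue_integral_translation (f : measurableTypeR R -> \bar R) (a : R) :
  measurable_fun setT f -> (forall x, 0 <= f x) ->
  \int[lebesgue_measure]_x f (x + a)%R = \int[lebesgue_measure]_x f x.
Proof.
move=> mf f0.
have ma : measurable_fun setT
    ((fun x => x + a)%R : measurableTypeR R -> measurableTypeR R).
  exact: measurable_funD.
pose pf := measure_function_pushforward__canonical__measure_function_Measure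
  (@lebesgue_measure R) ma.
transitivity (\int[pf]_x f x); last first.
  apply: (eq_measure_integral (@lebesgue_measure R)) => A mA _; apply/esym.
  apply: lebesgue_measure_unique => // X [[x y] _ <-] /=.
  rewrite /pushforward (_ : _ @^-1` _ = `](x - a)%R, (y - a)%R]%classic).
    rewrite !lebesgue_measure_itv/= !lte_fin ltrD2r -!EFinB.
    by rewrite opprB addrA subrK.
  by apply/seteqP; split => z /=; rewrite !in_itv/= ltrBlDr lerBrDr.
by rewrite ge0_integral_pushforward// preimage_setT.
Qed.

Lemma integral_rVS n (f : 'rV[R]_n.+1 -> \bar R) :
  measurable_fun setT f -> (forall x, 0 <= f x) ->
  \int[lebesgue_rV n.+1]_x f x =
  \int[lebesgue_measure]_a \int[lebesgue_rV n]_y f (rV_cons (a, y)).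
Proof.
move=> mf f0.
transitivity (\int[pushforward (@lebesgue_measure R \x lebesgue_rV n)
  (@rV_cons R n)]_x f x); first by [].
rewrite ge0_integral_pushforward//; last exact: measurable_rV_cons.
rewrite preimage_setT fubini_tonelli1//; last by move=> z; exact: f0.
apply: measurableT_comp => //; exact: measurable_rV_cons.
Qed.

Lemma rV_consD n (a b : R) (x y : 'rV[R]_n) :
  (rV_cons (a, x) + rV_cons (b, y) = rV_cons (a + b, x + y))%R.
Proof.
apply/rowP => i; rewrite mxE.
by case: (unliftP ord0 i) => [j|] ->; rewrite ?rV_consS ?rV_cons0//= mxE.
Qed.

Lemma rV_unconsK n (x : 'rV[R]_n.+1) : rV_cons (rV_uncons x) = x.
Proof.
by apply/rowP => i; case: (unliftP ord0 i) => [j|] ->;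
  rewrite ?rV_consS ?rV_cons0//= mxE.
Qed.

(** Induction on the dimension: Tonelli splits off the first coordinate, the inner integral is
    translated by the induction hypothesis and the outer one by the one-dimensional case. *)
Lemma integral_rV_translation n (f : 'rV[R]_n -> \bar R) (a : 'rV[R]_n) :
  measurable_fun setT f -> (forall x, 0 <= f x) ->
  \int[lebesgue_rV n]_x f (x + a)%R = \int[lebesgue_rV n]_x f x.
Proof.
elim: n f a => [|n ih] f a mf f0.
  by apply: eq_integral => x _; congr f; apply/rowP => -[].
have ma : measurable_fun setT (fun x : 'rV[R]_n.+1 => f (x + a)%R).
  by apply: (measurableT_comp mf); apply: measurable_fun_rVD => //; exact: measurable_cst.
rewrite integral_rVS// (integral_rVS mf f0).
have mcons : measurable_fun setT (fun z => f (rV_cons z)).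
  by apply: measurableT_comp => //; exact: measurable_rV_cons.
have mf' (b : R) : measurable_fun setT (fun y => f (rV_cons (b, y))).
  exact: (measurableT_comp mcons (pair1_measurable _)).
transitivity (\int[lebesgue_measure]_b \int[lebesgue_rV n]_y
    f (rV_cons (b + a ord0 ord0, y)%R)).
  apply: eq_integral => b _.
  rewrite -(ih (fun y => f (rV_cons (b + a ord0 ord0, y)%R)) (rV_uncons a).2)//.
  apply: eq_integral => y _.
  by rewrite -[in LHS](rV_unconsK a) rV_consD.
apply: (lebesgue_integral_translation
  (f := fun b => \int[lebesgue_rV n]_y f (rV_cons (b, y)))) => [|b].
  have mcons' : measurable_fun [set: measurableTypeR R * 'rV[R]_n]
      (fun z => f (rV_cons z)).
    by move=> _ Y mY; exact: (mcons measurableT Y mY).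
  have /= := @measurable_fun_fubini_tonelli_F _ _ _ _ R (lebesgue_rV n) _ mcons'
    (fun z => f0 _).
  exact.
exact: integral_ge0.
Qed.

Lemma lebesgue_rV_cube n (x : 'rV[R]_n) t : (0 <= t)%R ->
  lebesgue_rV n (cube x t) = ((2 * t) ^+ n)%:E.
Proof.
move=> t0; elim: n x => [|n ih] x.
  rewrite (_ : cube x t = setT).
    by rewrite /= diracE in_setT expr0.
  by apply/seteqP; split => // y _ /=; apply: normr_rV_le => // -[].
transitivity ((@lebesgue_measure R \x lebesgue_rV n)
   (@rV_cons R n @^-1` cube x t)) => //.
rewrite (_ : _ @^-1` _ = `[(x ord0 ord0 - t)%R, (x ord0 ord0 + t)%R]%classic `*`
    cube (\row_j x ord0 (lift ord0 j)) t).
  rewrite product_measure1E//; last exact: measurable_cube.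
  rewrite [X in _ * X]ih [X in X * _](_ : _ = (2 * t)%:E) -?EFinM ?exprS//.
  apply: (etrans (lebesgue_measure_itv _)); rewrite /= lte_fin.
  have [tt|tt] := ltP (x ord0 ord0 - t)%R (x ord0 ord0 + t)%R.
    rewrite -EFinB; congr EFin; lra.
  by congr EFin; lra.
apply/seteqP; split => -[a y]; rewrite !cubeE//=.
  move=> H; split => /=.
    by have := H ord0 I => /=; rewrite rV_cons0/= in_itv/= ler_distl.
  move=> i _ /=.
  by have := H (lift ord0 i) I => /=; rewrite rV_consS/= mxE.
move=> -[/= H1 H2] i _ /=.
case: (unliftP ord0 i) => [j|] ->.
  by have := H2 j I; rewrite /= rV_consS mxE.
by rewrite rV_cons0/= ler_distl; move: H1; rewrite in_itv.
Qed.

End lebesgue_rV_translation.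

(** * Integration of powers and the layer-cake formula *)

Section monotone_integral.
Context d (T : measurableType d) {R : realType}.
Variable mu : {measure set T -> \bar R}.
Local Open Scope ereal_scope.

(* No measurability is assumed: the K-functional is only bounded by measurable
   functions. *)
Lemma ge0_le_integral_nomeas (D : set T) (f g : T -> \bar R) :
  (forall x, D x -> 0 <= f x) -> (forall x, D x -> f x <= g x) ->
  \int[mu]_(x in D) f x <= \int[mu]_(x in D) g x.
Proof.
move=> f0 fg.
rewrite !ge0_integralE//; last by move=> x Dx; exact: le_trans (f0 x Dx) (fg x Dx).
apply: ge_ereal_sup => _ [h /= hf <-]; apply: ereal_sup_ubound; exists h => //= x.
apply: le_trans (hf x) _; rewrite /patch; case: ifPn => // /set_mem; exact: fg.
Qed.

End monotone_integral.

Section power_tail.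
Context {R : realType}.

Lemma powRN_cvg_pinfty (b : R) : 0 < b -> t `^ (- b) @[t --> +oo] --> 0.
Proof.
move=> b0; apply/cvgrPdist_lt => /= e e0; near=> t.
have t0 : 0 < t by near: t; apply: nbhs_pinfty_gt; exact: num_real.
rewrite sub0r normrN ger0_norm ?powR_ge0// powRN invf_plt ?posrE ?powR_gt0//.
have -> : e^-1 = (e^-1 `^ b^-1) `^ b.
  by rewrite -powRrM mulVf ?gt_eqF// powRr1// invr_ge0 ltW.
have te : e^-1 `^ b^-1 < t by near: t; apply: nbhs_pinfty_gt; exact: num_real.
by apply: gt0_ltr_powR => //; rewrite nnegrE ?powR_ge0// ltW.
Unshelve. all: by end_near. Qed.

Lemma integral_power_tail (a b : R) : 0 < a -> 0 < b ->
  (\int[lebesgue_measure]_(t in `[a, +oo[) (t `^ (- b - 1))%:E =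
   (a `^ (- b) / b)%:E)%E.
Proof.
move=> a0 b0.
pose F (t : R) := - (b^-1 * t `^ (- b)).
have dF (x : R) : 0 < x -> is_derive x 1 F (x `^ (- b - 1)).
  move=> x0.
  have H := is_derive1_powR (- b) x0.
  rewrite (_ : x `^ (- b - 1) = - (b^-1 *: (- b * x `^ (- b - 1)))).
    exact: is_deriveN.
  by rewrite /GRing.scale/= mulNr mulrN opprK mulrA mulVf ?mul1r// gt_eqF.
have cont (x c : R) : 0 < x -> {for x, continuous (fun t => t `^ c)}.
  move=> x0; apply/differentiable_continuous/derivable1_diffP.
  by have H := is_derive1_powR c x0; exact: ex_derive.
rewrite (@ge0_continuous_FTC2y _ _ F a 0).
- by rewrite sub0e -EFinN /F opprK mulrC.
- by move=> x _; exact: powR_ge0.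
- apply: continuous_in_subspaceT => x; rewrite inE/= in_itv/= andbT => ax.
  by apply: cont; exact: lt_le_trans ax.
- rewrite -[X in _ --> X]oppr0; apply: cvgN; rewrite -[X in _ --> X](mulr0 b^-1).
  by apply: cvgMr; exact: powRN_cvg_pinfty.
- by move=> x ax; have H := dF x (lt_trans a0 ax); exact: ex_derive.
- apply: cvg_at_right_filter; apply/differentiable_continuous/derivable1_diffP.
  by have H := dF a a0; exact: ex_derive.
- move=> x; rewrite in_itv/= andbT => ax.
  have H := dF x (lt_trans a0 ax); rewrite derive1E; exact: derive_val.
Qed.

End power_tail.

Section layer_cake.
Context d (T : measurableType d) {R : realType}.
Variable mu : {sigma_finite_measure set T -> \bar R}.
Variables (F w : T -> R) (b M : R).
Hypotheses (mF : measurable_fun setT F) (mw : measurable_fun setT w).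
Hypotheses (F0 : forall z, 0 <= F z) (w0 : forall z, 0 <= w z).
Hypothesis wF : forall z, w z = 0 -> F z = 0.
Hypotheses (b0 : 0 < b) (M0 : 0 < M).
Local Open Scope ereal_scope.

Let A := [set tz : measurableTypeR R * T | (0 < tz.1 /\ w tz.2 <= M * tz.1)%R].

Let mA : measurable A.
Proof.
rewrite (_ : A = fst @^-1` `]0%R, +oo[%classic `&` [set tz | (w tz.2 <= M * tz.1)%R]); last first.
  by apply/seteqP; split => tz /=; rewrite in_itv/= andbT.
apply: measurableI; rewrite -[X in measurable X]setTI.
  apply: (measurable_fst measurableT) => //; exact: measurable_itv.
apply: (@measurable_fun_le _ _ _ setT
  (fun tz : measurableTypeR R * T => w tz.2) (fun tz => M * tz.1)%R) => //.
  exact: measurableT_comp.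
by apply: measurable_funM.
Qed.

Let H (tz : measurableTypeR R * T) : \bar R :=
  (tz.1 `^ (- b - 1) * F tz.2 * \1_A tz)%:E.

Let mH : measurable_fun setT H.
Proof.
apply/measurable_EFinP; apply: measurable_funM; last exact: measurable_indic.
apply: measurable_funM; last exact: measurableT_comp.
by apply: (measurableT_comp (measurable_powR _)).
Qed.

Let H0 tz : 0 <= H tz.
Proof. by rewrite lee_fin !mulr_ge0 ?powR_ge0. Qed.

(** Tonelli on the set [A]: for fixed [z] the variable [t] runs over the half-line from [w z / M],
    and the power tail from there is [(w z / M)^(-b) / b]. *)
Lemma layer_cake :
  \int[lebesgue_measure]_(t in `]0%R, +oo[)
    ((t `^ (- b - 1))%:E * \int[mu]_(z in [set z | (w z <= M * t)%R]) (F z)%:E) =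
  (M `^ b / b)%:E * \int[mu]_z (F z / w z `^ b)%:E.
Proof.
have mS t : measurable [set z | (w z <= M * t)%R].
  by rewrite -[X in measurable X]setTI; exact: measurable_fun_le.
transitivity (\int[lebesgue_measure]_t \int[mu]_z H (t, z)).
  rewrite integral_mkcond; apply: eq_integral => t _.
  have [t0|t0] := ltP 0%R t; last first.
    rewrite patchN; last by apply/negP; rewrite inE/= in_itv/= andbT ltNge t0.
    rewrite integral0_eq// => z _; rewrite /H indicE memNset ?mulr0//= => -[/=].
    by rewrite ltNge t0.
  rewrite patchT; last by rewrite inE/= in_itv/= t0.
  rewrite -ge0_integralZl//; last 3 first.
  - by apply: measurable_funTS; exact/measurable_EFinP.
  - by move=> z _; rewrite lee_fin.
  - by rewrite lee_fin powR_ge0.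
  rewrite integral_mkcond; apply: eq_integral => z _.
  rewrite /H indicE/=; have [zt|zt] := pselect (w z <= M * t)%R.
    by rewrite patchT ?inE// mem_set// mulr1 -EFinM.
  rewrite patchN; last by apply/negP; rewrite inE.
  by rewrite memNset ?mulr0//= => -[].
rewrite (fubini_tonelli H mH H0)/=.
rewrite -ge0_integralZl//; last 3 first.
- apply/measurable_EFinP; apply: measurable_funM => //.
  rewrite (_ : (fun _ => _) = (fun z => w z `^ (- b))%R).
    by apply: (measurableT_comp (measurable_powR _)).
  by apply/funext => z; rewrite powRN.
- by move=> z _; rewrite lee_fin divr_ge0// powR_ge0.
- by rewrite lee_fin divr_ge0// ?powR_ge0// ltW.
apply: eq_integral => z _.
(* On the zero set of [w] the half-line starts at 0, where the power is not integrable; there [F]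
   vanishes by [wF], and both sides are 0. *)
have [wz|wz] := eqVneq (w z) 0%R.
  rewrite (wF wz) mul0r mule0 integral0_eq// => t _.
  by rewrite /H /= (wF wz) mulr0 mul0r.
have wz0 : (0 < w z)%R by rewrite lt_neqAle eq_sym wz w0.
transitivity (\int[lebesgue_measure]_(t in `[(w z / M)%R, +oo[)
    ((F z)%:E * (t `^ (- b - 1))%:E)).
  rewrite [RHS]integral_mkcond; apply: eq_integral => t _.
  rewrite /H indicE/=; have [zt|zt] := leP (w z / M)%R t.
    rewrite patchT; last by rewrite inE/= in_itv/= zt.
    rewrite mem_set ?mulr1 -?EFinM 1?mulrC//; split => /=.
      by rewrite (lt_le_trans _ zt)// divr_gt0.
    by rewrite mulrC -ler_pdivrMr.
  rewrite patchN; last by apply/negP; rewrite inE/= in_itv/= andbT leNgt zt.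
  rewrite memNset ?mulr0//= => -[/= _].
  by rewrite mulrC -ler_pdivrMr// leNgt zt.
rewrite ge0_integralZl//; last 3 first.
- by apply/measurable_EFinP; apply: measurable_funTS; exact: measurable_powR.
- by move=> t _; rewrite lee_fin powR_ge0.
- by rewrite lee_fin.
rewrite integral_power_tail ?divr_gt0// -!EFinM; congr EFin.
have Mb : (M^-1 `^ (- b) = M `^ b)%R.
  by rewrite -(powR_inv1 (ltW M0)) -powRrM mulN1r opprK.
rewrite powRM ?invr_ge0 ?(ltW M0)// Mb powRN; field.
by rewrite !gt_eqF ?powR_gt0.
Qed.

End layer_cake.

(** * Power inequalities and Jensen's inequality *)

Section power_inequalities.
Context {R : realType}.

Lemma lee_poweR (x y : \bar R) (p : R) :
  0 <= p -> (0 <= x)%E -> (x <= y)%E -> (x `^ p <= y `^ p)%E.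
Proof.
move=> p0 x0 xy; apply: gt0_ler_poweR => //; rewrite in_itv/= leey andbT//.
exact: le_trans xy.
Qed.

Lemma poweR_invK (x : \bar R) (p : R) :
  p != 0 -> (0 <= x)%E -> ((x `^ p^-1) `^ p = x)%E.
Proof. by move=> p0 x0; rewrite -poweRrM mulVf// poweRe1. Qed.

Lemma poweRK_inv (x : \bar R) (p : R) :
  p != 0 -> (0 <= x)%E -> ((x `^ p) `^ p^-1 = x)%E.
Proof. by move=> p0 x0; rewrite -poweRrM mulfV// poweRe1. Qed.

(** Each [a i] is at most the l^p norm of [a], so the sum is at most [n] times that norm. The
    constant is cruder than the convexity one, which is harmless here. *)
Lemma powR_sum_le n (a : 'I_n -> R) (p : R) : 0 < p -> (forall i, 0 <= a i) ->
  (\sum_i a i) `^ p <= n%:R `^ p * \sum_i a i `^ p.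
Proof.
move=> p0 a0; set S := \sum_i a i `^ p.
have S0 : 0 <= S by apply: sumr_ge0 => i _; exact: powR_ge0.
have aS i : a i <= S `^ p^-1.
  rewrite -[leLHS](@powRr1 _ (a i))// -(@mulfV _ p (lt0r_neq0 p0)) powRrM.
  apply: ge0_ler_powR; rewrite ?nnegrE ?powR_ge0 ?invr_ge0 ?(ltW p0)//.
  by rewrite /S (bigD1 i)//= lerDl sumr_ge0// => j _; exact: powR_ge0.
have sS : \sum_i a i <= n%:R * S `^ p^-1.
  apply: (le_trans (ler_sum _ (fun i _ => aS i))).
  by rewrite sumr_const card_ord mulr_natl.
apply: (@le_trans _ _ ((n%:R * S `^ p^-1) `^ p)).
  by apply: ge0_ler_powR; rewrite ?nnegrE ?mulr_ge0 ?powR_ge0 ?sumr_ge0 ?(ltW p0).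
by rewrite powRM ?powR_ge0// -powRrM mulVf ?gt_eqF// powRr1.
Qed.

Lemma powRD_le (a b p : R) : 0 < p -> 0 <= a -> 0 <= b ->
  (a + b) `^ p <= 2 `^ p * (a `^ p + b `^ p).
Proof.
move=> p0 a0 b0; have := @powR_sum_le 2 (fun i => if i == ord0 then a else b) p p0.
rewrite !big_ord_recl !big_ord0/= !addr0; apply => i; by case: ifP.
Qed.

End power_inequalities.

Section jensen.
Context d (T : measurableType d) {R : realType}.
Variable mu : {measure set T -> \bar R}.
Local Open Scope ereal_scope.

(** Hoelder against the indicator of [A] with conjugate exponent [q = p / (p - 1)]; the factor is
    [a^(p/q) = a^(p-1)]. *)
Lemma jensen_powR (A : set T) (a p : R) (f : T -> R) : (1 < p)%R ->
  measurable A -> mu A = a%:E -> measurable_fun setT f -> (forall x, 0 <= f x)%R ->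
  (\int[mu]_(x in A) (f x)%:E) `^ p <=
  (a `^ (p - 1))%:E * \int[mu]_(x in A) (f x `^ p)%:E.
Proof.
move=> p1 mA muA mf f0.
have p0 : (0 < p)%R by lra.
have a0 : (0 <= a)%R by rewrite -lee_fin -muA.
have p10 : (0 < p - 1)%R by lra.
pose q := (p / (p - 1))%R.
have q0 : (0 < q)%R by rewrite divr_gt0.
have pq : (p^-1 + q^-1 = 1)%R.
  rewrite /q invfM invrK; field; lra.
have mA1 : measurable_fun setT (\1_A : T -> R) by exact: measurable_indic.
pose g x := (f x * \1_A x)%R.
have mg : measurable_fun setT g by exact: measurable_funM.
have := hoelder mu mg mA1 p0 q0 pq.
rewrite Lnorm1 unlock /=.
have -> : \int[mu]_x `|((g \* \1_A) x)%:E| = \int[mu]_(x in A) (f x)%:E.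
  rewrite [RHS]integral_mkcond; apply: eq_integral => x _.
  rewrite /g/= patchE indicE; case: ifPn => xA; rewrite ?mulr1 ?mulr0 ?normr0//.
  by rewrite ger0_norm.
have -> : \int[mu]_x (`|(g x)%:E| `^ p) = \int[mu]_(x in A) (f x `^ p)%:E.
  rewrite [RHS]integral_mkcond; apply: eq_integral => x _.
  rewrite /g/= patchE indicE; case: ifPn => xA; rewrite ?mulr1 ?mulr0 ?normr0.
    by rewrite ger0_norm.
  by rewrite /= ?normr0 ?powR0 ?gt_eqF//.
have -> : \int[mu]_x (`|(\1_A x)%:E| `^ q) = a%:E.
  transitivity (\int[mu]_x (\1_A x)%:E).
    apply: eq_integral => x _; rewrite indicE; case: (x \in A) => /=.
      by rewrite /= ?normr1 ?powR1.
    by rewrite /= ?normr0 ?powR0 ?gt_eqF.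
  by rewrite integral_indic// setIT.
set I := \int[mu]_(x in A) (f x `^ p)%:E => H.
have I0 : 0 <= I by apply: integral_ge0 => x _; rewrite lee_fin powR_ge0.
have := lee_poweR (ltW p0) _ H; rewrite integral_ge0 => [/(_ isT)|x _]; last by rewrite lee_fin.
move=> /le_trans; apply.
rewrite poweRM ?poweR_ge0// poweR_invK ?gt_eqF// -poweRrM poweR_EFin muleC.
by rewrite (_ : (q^-1 * p = p - 1)%R)// /q invf_div mulrVK// unitfE gt_eqF.
Qed.

End jensen.

(** * Derivatives from remainder bounds, and functions with bounded derivatives *)

Section derivative_estimates.
Context {R : realType}.

(** A remainder bound of this form survives integration against an integrable function, so this
    criterion serves to differentiate convolutions, and also [flat] at 0. *)
Lemma is_derive_quadratic (V : normedModType R) (f : V -> R) (x v : V) (d C : R) :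
  (forall h, `|f (h *: v + x) - f x - h * d| <= C * h ^+ 2) ->
  is_derive x v f d.
Proof.
move=> H.
have C0 : 0 <= C by have := H 1; rewrite expr1n mulr1; exact: le_trans.
have L : h^-1 *: (f (h *: v + x) - f x) @[h --> 0^'] --> d.
  apply/cvgrPdist_lt => /= e e0; near=> h.
  have h0 : h != 0 by near: h; exact: nbhs_dnbhs_neq.
  have -> : d - h^-1 *: (f (h *: v + x) - f x) =
      - (h^-1 * (f (h *: v + x) - f x - h * d)).
    by rewrite /GRing.scale/=; field.
  rewrite normrN normrM normfV mulrC ltr_pdivrMr ?normr_gt0//.
  apply: le_lt_trans (H h) _.
  rewrite -real_normK ?num_real// expr2 mulrA ltr_pM2r ?normr_gt0//.
  apply: (@le_lt_trans _ _ ((C + 1) * `|h|)); first by rewrite ler_wpM2r// lerDl.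
  rewrite mulrC -ltr_pdivlMr; last lra.
  by near: h; apply: dnbhs0_lt; rewrite divr_gt0//; lra.
split; first by apply/cvg_ex; exists d.
exact: cvg_lim.
Unshelve. all: by end_near. Qed.

Lemma is_derive_continuous (f g : R -> R) :
  (forall x : R, is_derive x 1 f (g x)) -> continuous f.
Proof.
move=> fg x; apply/differentiable_continuous/derivable1_diffP.
by have H := fg x; exact: ex_derive.
Qed.

Lemma is_derive_within_continuous (f g : R -> R) (D : set R) :
  (forall x : R, is_derive x 1 f (g x)) -> {within D, continuous f}.
Proof. by move=> fg; apply: continuous_subspaceT; exact: is_derive_continuous fg. Qed.

Lemma bounded_derive_lipschitz (f g : R -> R) (M : R) :
  (forall x : R, is_derive x 1 f (g x)) -> (forall x, `|g x| <= M) ->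
  forall x y, `|f x - f y| <= M * `|x - y|.
Proof.
move=> fg gM x y; wlog xy : x y / x <= y.
  by move=> W; have [/W//|/ltW/W] := leP x y; rewrite distrC (distrC x).
have [c _ E] := MVT_segment xy (fun z _ => fg z)
  (is_derive_within_continuous (D := `[x, y]%classic) fg).
by rewrite distrC E normrM (distrC x) ler_wpM2r.
Qed.

(** The mean value theorem gives [f (x + h) - f x = h g(c)] with [c] within [|h|] of [x], and [g] is
    [M]-Lipschitz. Hence the constant [M] instead of the sharp [M / 2]. *)
Lemma bounded_derive2_taylor (f g k : R -> R) (M : R) :
  (forall x : R, is_derive x 1 f (g x)) -> (forall x : R, is_derive x 1 g (k x)) ->
  (forall x, `|k x| <= M) ->
  forall x h, `|f (x + h) - f x - h * g x| <= M * h ^+ 2.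
Proof.
move=> fg gk kM x h.
have gL := bounded_derive_lipschitz gk kM.
have M0 : 0 <= M by apply: le_trans (kM 0).
have [c cxh E] : exists2 c, `|c - x| <= `|h| & f (x + h) - f x = g c * h.
  have [h0|h0] := leP 0 h.
    have xh : x <= x + h by rewrite lerDl.
    have [c cx E] := MVT_segment xh (fun z _ => fg z)
      (is_derive_within_continuous (D := `[x, x + h]%classic) fg).
    exists c; last by rewrite E addrAC subrr add0r.
    move: cx; rewrite in_itv/= => /andP[c1 c2].
    by rewrite !ger0_norm ?subr_ge0// lerBlDl.
  have xh : x + h <= x by rewrite gerDl ltW.
  have [c cx E] := MVT_segment xh (fun z _ => fg z)
    (is_derive_within_continuous (D := `[x + h, x]%classic) fg).
  exists c; last by rewrite -opprB E opprD addrA subrr sub0r mulrN opprK.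
  move: cx; rewrite in_itv/= => /andP[c1 c2].
  rewrite ler0_norm ?subr_le0// ltr0_norm// opprB; lra.
rewrite E mulrC -mulrBr normrM -real_normK ?num_real// expr2 mulrCA.
rewrite ler_wpM2l//; apply: le_trans (gL _ _) _.
by rewrite ler_wpM2l.
Qed.

End derivative_estimates.

Section bounded_derivatives.
Context {R : realType}.
Implicit Types f g : R -> R.

(** The derivative is an existential witness at each order, so closure under sums, products and
    affine substitutions is a plain induction on [k], without formulas for iterated derivatives. *)
Fixpoint bounded_derivatives k f : Prop :=
  (exists M : R, forall x, `|f x| <= M) /\
  if k is k'.+1 then
    exists g, (forall x : R, is_derive x 1 f (g x)) /\ bounded_derivatives k' g
  else True.

Lemma bounded_derivatives_bounded k f :
  bounded_derivatives k f -> exists M : R, forall x, `|f x| <= M.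
Proof. by case: k => [|k] []. Qed.

Lemma bounded_derivativesW k f :
  bounded_derivatives k.+1 f -> bounded_derivatives k f.
Proof.
elim: k f => [|k ih] f [fM [g [fg bg]]]; split => //.
by exists g; split => //; exact: ih.
Qed.

Lemma bounded_derivatives_cst k c : bounded_derivatives k (cst c).
Proof.
elim: k c => [|k ih] c; split => //; try by exists `|c|.
exists (cst 0); split => // x; exact: is_derive_cst.
Qed.

Lemma bounded_derivativesD k f g : bounded_derivatives k f ->
  bounded_derivatives k g -> bounded_derivatives k (f \+ g).
Proof.
have B f' g' : (exists M : R, forall x, `|f' x| <= M) ->
    (exists M : R, forall x, `|g' x| <= M) ->
    exists M : R, forall x : R, `|(f' \+ g') x| <= M :> R.
  move=> [M fM] [N gN]; exists (M + N) => x.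
  by rewrite (le_trans (ler_normD _ _))// lerD.
elim: k f g => [|k ih] f g [fM fd] [gM gd]; split => //; try exact: B.
move: fd gd => [f' [ff' bf']] [g' [gg' bg']]; exists (f' \+ g'); split.
  by move=> x; have := ff' x; have := gg' x; move=> ? ?; exact: is_deriveD.
exact: ih.
Qed.

Lemma bounded_derivativesM k f g : bounded_derivatives k f ->
  bounded_derivatives k g -> bounded_derivatives k (f \* g).
Proof.
have B f' g' : (exists M : R, forall x, `|f' x| <= M) ->
    (exists M : R, forall x, `|g' x| <= M) ->
    exists M : R, forall x : R, `|(f' \* g') x| <= M :> R.
  move=> [M fM] [N gN]; exists (M * N) => x.
  by rewrite normrM ler_pM.
elim: k f g => [|k ih] f g bf bg.
  by split => //; apply: B; [case: bf|case: bg].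
have wf := bounded_derivativesW bf; have wg := bounded_derivativesW bg.
move: bf bg => [fM [f' [ff' bf']]] [gM [g' [gg' bg']]]; split; first exact: B.
exists ((f \* g') \+ (g \* f')); split; last first.
  by apply: bounded_derivativesD; exact: ih.
by move=> x; have := ff' x; have := gg' x; move=> ? ?; exact: is_deriveM.
Qed.

Lemma bounded_derivatives_affine k f a b : bounded_derivatives k f ->
  bounded_derivatives k (fun x => f (a * x + b)).
Proof.
elim: k f => [|k ih] f [[M fM] fd]; split => //; try by exists M.
move: fd => [f' [ff' bf']]; exists ((fun x => f' (a * x + b)) \* cst a); split.
  move=> x; have := ff' (a * x + b) => fa.
  have ab : is_derive x 1 (fun x : R => a * x + b) a.
    by apply: is_derive_eq; rewrite /GRing.scale/= mulr1 addr0.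
  change (is_derive x 1 (f \o (fun x => a * x + b)) (f' (a * x + b) * a)).
  exact: is_derive1_comp.
by apply: bounded_derivativesM; [exact: ih|exact: bounded_derivatives_cst].
Qed.

End bounded_derivatives.

(** * A smooth bump on the line *)

Section flat.
Context {R : realType}.
Implicit Types q : {poly R}.

(* The derivative of q(1/x) exp(-1/x) has the same form, with polynomial
   X^2 (q - q'). *)
Definition flat q (x : R) := if 0 < x then q.[x^-1] * expR (- x^-1) else 0.

(** Coefficient by coefficient: the exponential series gives [y^i exp(-y) <= i!] for [y >= 0]. *)
Lemma poly_expRN_bounded q :
  exists C : R, forall y : R, 0 <= y -> `|q.[y] * expR (- y)| <= C.
Proof.
exists (\sum_(i < size q) `|q`_i| * i`!%:R) => y y0.
rewrite horner_coef mulr_suml (le_trans (ler_norm_sum _ _ _))//.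
apply: ler_sum => i _; rewrite -mulrA normrM ler_wpM2l//.
rewrite ger0_norm ?mulr_ge0 ?exprn_ge0 ?expR_ge0// expRN ler_pdivrMr ?expR_gt0//.
case: (i : nat) => [|k].
  by rewrite expr0 mul1r -expR0 ler_expR.
have f0 : 0 < k.+1`!%:R :> R by rewrite ltr0n fact_gt0.
rewrite mulrC -ler_pdivrMr//; apply: le_trans (expR_ge1Dxn k y0).
by rewrite lerDr.
Qed.

Lemma flat_bounded q : exists C : R, forall x : R, `|flat q x| <= C.
Proof.
have [C HC] := poly_expRN_bounded q.
have C0 : 0 <= C by apply: le_trans (HC 0 _).
exists C => x; rewrite /flat; case: ifPn => x0; last by rewrite normr0.
by apply: HC; rewrite invr_ge0 ltW.
Qed.

Lemma flat_sqr q x : flat q x = x ^+ 2 * flat ('X^2 * q) x.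
Proof.
rewrite /flat; case: ifPn => x0; last by rewrite mulr0.
by rewrite hornerM hornerXn; field; rewrite gt_eqF.
Qed.

Lemma flat_derive q (x : R) : is_derive x 1 (flat q) (flat ('X^2 * (q - q^`())) x).
Proof.
have [x0|x0|x0] := ltgtP x 0.
- rewrite [flat _ x]/flat ltNge ltW//=.
  apply: (@near_eq_is_derive _ _ _ (cst 0)).
  near=> y; rewrite /flat ltNge ltW//=.
  by near: y; exact: lt_nbhsl.
- rewrite [flat _ x]/flat x0.
  apply: (@near_eq_is_derive _ R R (fun y : R => q.[y^-1] * expR (- y^-1))).
    near=> y; rewrite /flat ifT//; near: y; exact: lt_nbhsr.
  have xn0 : x != 0 by rewrite gt_eqF.
  have dV : is_derive x 1 (fun y : R => y^-1) (- x ^- 2).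
    have H := is_deriveV xn0 (is_derive_id x 1).
    by rewrite /GRing.scale/= mulr1 in H.
  have dq : is_derive x 1 (fun y : R => q.[y^-1]) (q^`().[x^-1] * - x ^- 2).
    change (is_derive x 1 (horner q \o (fun y : R => y^-1))
      (q^`().[x^-1] * - x ^- 2)).
    exact: is_derive1_comp.
  have dN : is_derive x 1 (fun y : R => - y^-1) (x ^- 2).
    by rewrite -[x ^- 2]opprK; exact: is_deriveN.
  have de : is_derive x 1 (fun y : R => expR (- y^-1)) (expR (- x^-1) * x ^- 2).
    change (is_derive x 1 (expR \o (fun y : R => - y^-1)) (expR (- x^-1) * x ^- 2)).
    exact: is_derive1_comp.
  have H := is_deriveM dq de.
  apply: (is_derive_eq H); rewrite /GRing.scale/= hornerM hornerXn hornerD hornerN.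
  by field.
(* At 0 the function and the claimed derivative both vanish; [flat_sqr] extracts [h^2] from
   [flat q h], and the remaining factor is bounded. *)
- subst x; rewrite [flat _ 0]/flat ltxx.
  have [C HC] := flat_bounded ('X^2 * q).
  apply: (@is_derive_quadratic _ _ _ _ _ _ C) => h.
  rewrite mulr0 subr0 addr0 [flat q 0]/flat ltxx subr0 /GRing.scale/= mulr1.
  by rewrite flat_sqr normrM (ger0_norm (sqr_ge0 h)) (mulrC C) ler_wpM2l ?sqr_ge0.
Unshelve. all: by end_near. Qed.

Lemma flat_bounded_derivatives k q : bounded_derivatives k (flat q).
Proof.
elim: k q => [|k ih] q; split => //; try exact: flat_bounded.
by exists (flat ('X^2 * (q - q^`()))); split => //; exact: flat_derive.
Qed.

End flat.

Section bump.
Context {R : realType}.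

(** For [0 < t] and [|x| < t] this is [exp (-2 / (1 - (x/t)^2))], the standard bump, split into two
    factors that are affine substitutes of [flat 1]. *)
Definition bump1 (t x : R) := flat 1 (t^-1 * x + 1) * flat 1 (- t^-1 * x + 1).

Lemma bump1_bounded_derivatives k t : bounded_derivatives k (bump1 t).
Proof.
apply: bounded_derivativesM; apply: bounded_derivatives_affine;
  exact: flat_bounded_derivatives.
Qed.

Lemma flat1_ge0 (x : R) : 0 <= flat 1 x.
Proof. by rewrite /flat hornerE mul1r; case: ifP; rewrite ?expR_ge0. Qed.

Lemma flat1_le1 (x : R) : flat 1 x <= 1.
Proof.
rewrite /flat hornerE mul1r; case: ifP => // x0.
by rewrite -expR0 ler_expR oppr_le0 invr_ge0 ltW.
Qed.

Lemma le_flat1 (x y : R) : x <= y -> flat 1 x <= flat 1 y.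
Proof.
move=> xy; have [x0|x0] := leP x 0.
  by rewrite {1}/flat ltNge x0/= flat1_ge0.
have y0 := lt_le_trans x0 xy.
by rewrite /flat x0 y0 !hornerE ?mul1r ler_expR lerN2 lef_pV2.
Qed.

Lemma bump1_ge0 t x : 0 <= bump1 t x.
Proof. by rewrite mulr_ge0// flat1_ge0. Qed.

Lemma bump1_le1 t x : bump1 t x <= 1.
Proof. by rewrite mulr_ile1 ?flat1_ge0 ?flat1_le1. Qed.

Lemma bump1_supp t x : 0 < t -> bump1 t x != 0 -> `|x| <= t.
Proof.
move=> t0; rewrite mulf_eq0 negb_or /flat => /andP[].
case: ifP => [h1 _|]; last by rewrite eqxx.
case: ifP => [h2 _|]; last by rewrite eqxx.
have E : x = t * (t^-1 * x) by rewrite mulrA mulfV ?mul1r// gt_eqF.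
rewrite E normrM gtr0_norm// ger_pMr// ler_norml; lra.
Qed.

(** For [|x| <= t / 2] both arguments of [flat 1] in [bump1 t x] are at least [1/2], which makes
    this a lower bound independent of [t]. *)
Definition bump_min : R := flat 1 2^-1 ^+ 2.

Lemma bump_min_gt0 : 0 < bump_min.
Proof. by rewrite exprn_gt0// /flat invr_gt0 ltr0n hornerE mul1r expR_gt0. Qed.

Lemma bump1_min t x : 0 < t -> `|x| <= t / 2 -> bump_min <= bump1 t x.
Proof.
move=> t0 xt.
have : `|t^-1 * x| <= 2^-1.
  by rewrite normrM gtr0_norm ?invr_gt0// mulrC ler_pdivrMr// mulrC.
rewrite ler_norml => /andP[h1 h2].
rewrite /bump_min expr2 ler_pM ?flat1_ge0// le_flat1//; lra.
Qed.

(** All bumps are dilates of one: [bump1 t z = bump1 1 (z / t)]. So [K] is chosen before [t] and the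
    Lipschitz constant scales as [1 / t]. *)
Lemma bump1_lipschitz : exists2 K, 0 <= K &
  forall t x y, 0 < t -> `|bump1 t x - bump1 t y| <= K / t * `|x - y|.
Proof.
have [_ [g [fg bg]]] := bump1_bounded_derivatives 1 1.
have [K gK] := bounded_derivatives_bounded (k := 0) bg.
exists K; first by apply: le_trans (gK 0).
move=> t x y t0.
have E z : bump1 t z = bump1 1 (z / t).
  by rewrite /bump1 invr1 mulN1r mul1r mulNr (mulrC z).
rewrite !E; apply: le_trans (bounded_derive_lipschitz fg gK _ _) _.
by rewrite -mulrBl normrM [`|t^-1|]gtr0_norm ?invr_gt0// (mulrC `|_|) mulrA.
Qed.

End bump.

(** * Products of one-variable functions and increments along the axes *)

Section tensor.
Context {R : realType} {n : nat}.
Implicit Types (F : 'I_n -> R -> R) (x z h : 'rV[R]_n).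

Definition axis (j : 'I_n) : 'rV[R]_n := delta_mx ord0 j.

Lemma axisE (j i : 'I_n) (s : R) x : (s *: axis j + x) ord0 i = s * (i == j)%:R + x ord0 i.
Proof. by rewrite !mxE eqxx. Qed.

Lemma normr_axis (j : 'I_n) (s : R) : `|s *: axis j| <= `|s|.
Proof.
apply: normr_rV_le => // i; rewrite /axis !mxE eqxx/=.
by case: eqP; rewrite ?mulr1// mulr0 normr0.
Qed.

Definition tensor F x := \prod_i F i (x ord0 i).

(** Differentiating a tensor along axis [j] amounts to replacing its factor [j] by the derivative,
    so the class of tensors is stable under partial derivatives. *)
Definition set_factor F j (g : R -> R) := fun i => if i == j then g else F i.

Lemma tensor_set_factor F j g x :
  tensor (set_factor F j g) x = g (x ord0 j) * \prod_(i | i != j) F i (x ord0 i).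
Proof.
rewrite /tensor (bigD1 j)//= /set_factor eqxx; congr *%R.
by apply: eq_bigr => i /negbTE ->.
Qed.

Lemma tensor_axis F j (s : R) x : tensor F (s *: axis j + x) =
  F j (x ord0 j + s) * \prod_(i | i != j) F i (x ord0 i).
Proof.
rewrite /tensor (bigD1 j)//= axisE eqxx mulr1 addrC; congr *%R.
by apply: eq_bigr => i /negbTE ij; rewrite axisE ij mulr0 add0r.
Qed.

Lemma tensorE F j x :
  tensor F x = F j (x ord0 j) * \prod_(i | i != j) F i (x ord0 i).
Proof. by rewrite /tensor (bigD1 j). Qed.

Definition smooth_factors F := forall i k, bounded_derivatives k (F i).

Lemma prod_factors_bounded F (P : pred 'I_n) : smooth_factors F ->
  exists2 K, 0 <= K & forall x, `|\prod_(i | P i) F i (x ord0 i)| <= K.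
Proof.
move=> sF; have /choice[M FM] : forall i, exists M : R, forall y, `|F i y| <= M.
  by move=> i; exact: bounded_derivatives_bounded (sF i 0%N).
exists (\prod_(i | P i) `|M i|); first by rewrite prodr_ge0.
move=> x; rewrite normr_prod; apply: ler_prod => i _; rewrite normr_ge0/=.
exact: le_trans (FM i _) (ler_norm _).
Qed.

Lemma tensor_bounded F : smooth_factors F ->
  exists2 K, 0 <= K & forall x, `|tensor F x| <= K.
Proof. exact: prod_factors_bounded. Qed.

(** Only the factor [j] moves along axis [j], and the product of the others is bounded. The
    one-variable estimates thus hold uniformly in [x], which lets them be integrated later. *)
Lemma smooth_factors_deriv F j : smooth_factors F ->
  exists g, [/\ smooth_factors (set_factor F j g),
    (exists2 L, 0 <= L & forall s x, `|tensor F (s *: axis j + x) - tensor F x| <= L * `|s|) &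
    exists2 C, 0 <= C & forall s x, `|tensor F (s *: axis j + x) - tensor F x -
      s * tensor (set_factor F j g) x| <= C * s ^+ 2].
Proof.
(* [bounded_derivatives] yields a witness for each order separately; the canonical derivative equals
   all of them, so a single [g] serves every [k]. *)
move=> sF; pose f := F j; pose g : R -> R := f^`()%classic.
have fgk k : (forall x : R, is_derive x 1 f (g x)) /\ bounded_derivatives k g.
  have [_ [g' [fg' bg']]] := sF j k.+1.
  have -> : g = g' by apply/funext => x; have H := fg' x; rewrite /g derive1E derive_val.
  by [].
have fg := (fgk 0%N).1.
have [M gM] := bounded_derivatives_bounded (fgk 0%N).2.
have [_ [k [gk bk]]] := (fgk 1%N).2.
have [M' kM'] := bounded_derivatives_bounded (k := 0) bk.
have M0 : 0 <= M by apply: le_trans (gM 0).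
have M'0 : 0 <= M' by apply: le_trans (kM' 0).
have [K K0 FK] := prod_factors_bounded (fun i => i != j) sF.
exists g; split.
- by move=> i l; rewrite /set_factor; case: eqP => // _; exact: (fgk l).2.
- exists (M * K) => [|s x]; first exact: mulr_ge0.
  rewrite tensor_axis (tensorE F j) -mulrBl normrM mulrAC ler_pM//.
  have := bounded_derive_lipschitz fg gM (x ord0 j + s) (x ord0 j).
  by rewrite [x ord0 j + s - _]addrAC subrr add0r.
- exists (M' * K) => [|s x]; first exact: mulr_ge0.
  rewrite tensor_axis (tensorE F j) tensor_set_factor mulrA -!mulrBl normrM mulrAC ler_pM//.
  exact: bounded_derive2_taylor.
Qed.

Lemma measurable_tensor F : smooth_factors F -> measurable_fun setT (tensor F).
Proof.
move=> sF; apply: measurable_prod => i _.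
have [_ [g [fg _]]] := sF i 1%N.
apply: (measurableT_comp (f := F i)); last exact: measurable_rV_coord.
by apply: continuous_measurable_fun; exact: is_derive_continuous fg.
Qed.

End tensor.

Lemma lipschitz_continuous {R : realType} (V : normedModType R) (L : R) (v : V -> R) :
  0 <= L -> (forall x h, `|v (x + h) - v x| <= L * `|h|) -> continuous v.
Proof.
move=> L0 vL x; apply/cvgrPdist_lt => /= e e0.
have L1 : 0 < L + 1 by lra.
near=> y; rewrite distrC -[y](subrK x) [y - x + x]addrC.
apply: le_lt_trans (vL _ _) _.
have yd : `|y - x| < e / (L + 1).
  near: y; apply/nbhs_ballP; exists (e / (L + 1)) => /=; first by rewrite divr_gt0.
  by move=> y; rewrite -ball_normE/= distrC.
apply: (@le_lt_trans _ _ ((L + 1) * `|y - x|)).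
  by rewrite ler_wpM2r// lerDl.
by rewrite mulrC -ltr_pdivlMr.
Unshelve. all: by end_near. Qed.

Section rV_lines.
Context {R : realType} {n : nat}.
Implicit Types x h : 'rV[R]_n.

(* Partial translate by the first [k] coordinates of [h]: consecutive corners
   differ along one axis, which replaces the chain rule. *)
Definition corner x h (k : nat) := x + \row_i (if (i < k)%N then h ord0 i else 0).

Lemma corner_step x h (j : 'I_n) :
  corner x h j.+1 = h ord0 j *: axis j + corner x h j.
Proof.
apply/rowP => i; rewrite axisE !mxE ltnS leq_eqVlt.
have [->|ij] := eqVneq i j; first by rewrite eqxx ltnn/= mulr1 addr0 addrC.
rewrite mulr0 add0r (_ : (i == j :> nat) = false)//.
by apply/negbTE; apply: contra ij => /eqP/val_inj ->.
Qed.

Lemma corner_telescope (v : 'rV[R]_n -> R) x h : v (x + h) - v x =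
  \sum_(j < n) (v (h ord0 j *: axis j + corner x h j) - v (corner x h j)).
Proof.
under eq_bigr do rewrite -corner_step.
rewrite -(big_mkord xpredT (fun k => v (corner x h k.+1) - v (corner x h k))).
rewrite telescope_sumr//; congr (v _ - v _); apply/rowP => i; rewrite !mxE.
  by rewrite ltn_ord.
by rewrite addr0.
Qed.

Lemma axis_lipschitz_continuous (v : 'rV[R]_n -> R) (L : R) : 0 <= L ->
  (forall j s x, `|v (s *: axis j + x) - v x| <= L * `|s|) -> continuous v.
Proof.
move=> L0 vL; apply: (@lipschitz_continuous _ _ (n%:R * L)) => [|x h].
  exact: mulr_ge0.
rewrite corner_telescope (le_trans (ler_norm_sum _ _ _))//.
apply: (@le_trans _ _ (\sum_(j < n) L * `|h|)).
  by apply: ler_sum => j _; rewrite (le_trans (vL _ _ _))// ler_wpM2l// coord_le_normr.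
by rewrite sumr_const card_ord -[leLHS]mulr_natl mulrA.
Qed.

End rV_lines.

(** Coinduction principle: iterated partial derivatives never leave [S]. It is applied to the class
    of convolutions of a fixed [g] with all smooth tensors. *)
Lemma smooth_coind {R : realType} {n : nat} (S : set ('rV[R]_n.+1 -> R)) :
  (forall f, S f -> continuous f /\
     forall i, S (partial i f) /\ forall x, derivable f x (delta_mx ord0 i)) ->
  S `<=` smooth.
Proof.
move=> H f Sf l; have : S (foldr partial f l).
  by elim: l => //= i l /H[_ /(_ i)[]].
by move=> /H[cf df]; split => // i x; exact: (df i).2.
Qed.

(** * Convolution of an integrable function with a smooth tensor *)

Section bounded_times_integrable.
Context d (T : measurableType d) {R : realType}.
Variable mu : {measure set T -> \bar R}.
Variables (g : T -> R).
Hypothesis ig : mu.-integrable setT (EFin \o g).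

Lemma integrable_boundedM (phi : T -> R) (K : R) : measurable_fun setT phi ->
  (forall y, `|phi y| <= K) -> mu.-integrable setT (EFin \o (fun y => phi y * g y)).
Proof.
move=> mphi phiK.
have mg : measurable_fun setT g by apply/measurable_EFinP; exact: measurable_int ig.
have K0 (y : T) : 0 <= K by apply: le_trans (phiK y).
apply: (@le_integrable _ _ _ mu setT measurableT _ (fun y => K%:E * (EFin \o g) y)%E).
- by apply/measurable_EFinP; exact: measurable_funM.
- move=> y _ /=; rewrite lee_fin !normrM.
  by rewrite ler_wpM2r// (ger0_norm (K0 y)).
- exact: integrableZl.
Qed.

Lemma Rintegral_boundedM_le (phi : T -> R) (K : R) : measurable_fun setT phi ->
  (forall y, `|phi y| <= K) ->
  `|\int[mu]_y (phi y * g y)| <= K * \int[mu]_y `|g y|.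
Proof.
move=> mphi phiK; have iphi := integrable_boundedM mphi phiK.
apply: le_trans (le_normr_Rintegral measurableT iphi) _.
rewrite -RintegralZl//; last exact: integrable_norm.
apply: le_Rintegral => //.
- exact: (integrable_norm iphi).
- apply: (@integrableZl _ _ _ mu setT measurableT K (EFin \o (Num.norm \o g))).
  exact: integrable_norm.
- by move=> y _; rewrite normrM ler_wpM2r.
Qed.

End bounded_times_integrable.

Section convolution.
Context {R : realType} {n : nat}.
Variable g : 'rV[R]_n -> R.
Hypothesis ig : (lebesgue_rV n).-integrable setT (EFin \o g).
Local Notation mu := (lebesgue_rV n).

Definition conv (F : 'I_n -> R -> R) (x : 'rV[R]_n) : R :=
  \int[mu]_y (tensor F (x - y) * g y).

Lemma measurable_tensorB (F : 'I_n -> R -> R) x : smooth_factors F ->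
  measurable_fun setT (fun y : 'rV[R]_n => tensor F (x - y)).
Proof.
move=> sF; apply: (measurableT_comp (measurable_tensor sF)).
by apply: measurable_fun_rVB => //; exact: measurable_cst.
Qed.

Lemma integrable_conv F x : smooth_factors F ->
  mu.-integrable setT (EFin \o (fun y => tensor F (x - y) * g y)).
Proof.
move=> sF; have [K K0 FK] := tensor_bounded sF.
apply: (integrable_boundedM ig (K := K)) => //; exact: measurable_tensorB.
Qed.

Lemma conv_axisB F j s x : smooth_factors F ->
  conv F (s *: axis j + x) - conv F x =
  \int[mu]_y ((tensor F (s *: axis j + (x - y)) - tensor F (x - y)) * g y).
Proof.
move=> sF; rewrite -RintegralB//; try exact: integrable_conv.
by apply: eq_Rintegral => y _; rewrite mulrBl addrA.
Qed.

Lemma measurable_tensor_axisB F j s x : smooth_factors F ->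
  measurable_fun setT
    (fun y : 'rV[R]_n => tensor F (s *: axis j + (x - y)) - tensor F (x - y)).
Proof.
move=> sF; apply: measurable_funB; last exact: measurable_tensorB.
under eq_fun do rewrite addrA; exact: measurable_tensorB.
Qed.

Lemma conv_continuous F : smooth_factors F -> continuous (conv F).
Proof.
move=> sF.
have H j : exists2 L, 0 <= L &
    forall s x, `|tensor F (s *: axis j + x) - tensor F x| <= L * `|s|.
  by have [h []] := smooth_factors_deriv j sF.
have /choice[L HL] : forall j, exists L, 0 <= L /\
    forall s x, `|tensor F (s *: axis j + x) - tensor F x| <= L * `|s|.
  by move=> j; have [L ? ?] := H j; exists L.
have G0 : 0 <= \int[mu]_y `|g y| by apply: Rintegral_ge0.
apply: (@axis_lipschitz_continuous _ _ _ (\sum_j L j * \int[mu]_y `|g y|)).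
  by apply: sumr_ge0 => j _; rewrite mulr_ge0//; case: (HL j).
move=> j s x; rewrite conv_axisB//.
apply: (@le_trans _ _ (L j * `|s| * \int[mu]_y `|g y|)).
  apply: Rintegral_boundedM_le => //; first exact: measurable_tensor_axisB.
  by move=> y; exact: (HL j).2.
rewrite mulrAC ler_wpM2r// (bigD1 j)//= lerDl sumr_ge0// => i _.
by rewrite mulr_ge0//; case: (HL i).
Qed.

(** The Taylor remainder of the kernel along axis [j] is at most [C s^2] wherever the kernel is
    evaluated; integrating against [g] multiplies the bound by the L^1 norm of [g]. *)
Lemma conv_is_derive F j : smooth_factors F -> exists G, smooth_factors G /\
  forall x, is_derive x (axis j) (conv F) (conv G x).
Proof.
move=> sF; have [h [sG _ [C C0 HC]]] := smooth_factors_deriv j sF.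
exists (set_factor F j h); split => // x.
apply: (@is_derive_quadratic _ _ _ _ _ _ (C * \int[mu]_y `|g y|)) => s.
rewrite conv_axisB// -RintegralZl//; last exact: integrable_conv.
rewrite -RintegralB//; last 2 first.
- have [L [L0 HL]] : exists L, 0 <= L /\
      forall s x, `|tensor F (s *: axis j + x) - tensor F x| <= L * `|s|.
    by have [_ [_ [L ? ?] _]] := smooth_factors_deriv j sF; exists L.
  apply: (integrable_boundedM ig (K := L * `|s|)) => //.
  exact: measurable_tensor_axisB.
- by apply: (@integrableZl _ _ _ mu setT measurableT s
    (EFin \o (fun y => tensor (set_factor F j h) (x - y) * g y))); exact: integrable_conv.
rewrite mulrAC (_ : (\int[mu]_y _)%R = \int[mu]_y ((tensor F (s *: axis j + (x - y)) -
  tensor F (x - y) - s * tensor (set_factor F j h) (x - y)) * g y)); last first.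
  by apply: eq_Rintegral => y _; rewrite [in RHS]mulrBl mulrA.
apply: Rintegral_boundedM_le => //; apply: measurable_funB.
  exact: measurable_tensor_axisB.
by apply: measurable_funM => //; exact: measurable_tensorB.
Qed.

End convolution.

Lemma conv_smooth {R : realType} {n : nat} (g : 'rV[R]_n.+1 -> R)
    (F : 'I_n.+1 -> R -> R) :
  (lebesgue_rV n.+1).-integrable setT (EFin \o g) -> smooth_factors F ->
  smooth (conv g F).
Proof.
move=> ig sF.
apply: (@smooth_coind _ _ [set f | exists2 G, smooth_factors G & f = conv g G]);
  last by exists F.
move=> _ [G sG ->]; split; first exact: conv_continuous.
move=> i; have [H [sH dH]] := conv_is_derive ig i sG; split.
  by exists H => //; apply/funext => x; have D := dH x; exact: derive_val.
by move=> x; have D := dH x; exact: ex_derive.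
Qed.

(** * Integrals over neighbourhoods of the diagonal *)

Section strip_integrals.
Context {R : realType} {n : nat}.
Local Notation mu := (lebesgue_rV n).
Local Notation V := ('rV[R]_n).
Implicit Types (f : V * V -> R) (u g : V -> R) (r : R).
Local Open Scope ereal_scope.

Definition strip r := [set z : V * V | `|z.1 - z.2| <= r]%R.

Lemma measurable_distance : measurable_fun setT (fun z : V * V => `|z.1 - z.2|%R).
Proof.
apply: (measurableT_comp (@measurable_normr_rV R n)).
by apply: measurable_fun_rVB.
Qed.

Lemma measurable_strip r : measurable (strip r).
Proof.
rewrite -[strip r]setTI.
apply: (@measurable_fun_le _ _ _ setT (fun z : V * V => `|z.1 - z.2|%R) (cst r)) => //.
exact: measurable_distance.
Qed.

Lemma strip_integral1 f r : measurable_fun setT f -> (forall z, 0 <= f z)%R ->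
  \int[mu \x mu]_(z in strip r) (f z)%:E =
  \int[mu]_x \int[mu]_(y in cube x r) (f (x, y))%:E.
Proof.
move=> mf f0; rewrite integral_mkcond fubini_tonelli1/=.
- apply: eq_integral => x _; rewrite [RHS]integral_mkcond.
  apply: eq_integral => y _; rewrite !patchE; congr (if _ then _ else _).
  by apply/idP/idP; rewrite !inE /cube/strip/= distrC.
- apply/measurable_restrict => //; first exact: measurable_strip.
  by apply: measurable_funTS; exact/measurable_EFinP.
- by move=> z; apply: erestrict_ge0 => y _; rewrite lee_fin.
Qed.

(** The integrands compared later are not symmetric in the two variables, so both orders are
    recorded; this one serves quantities that depend on the second variable alone. *)
Lemma strip_integral2 f r : measurable_fun setT f -> (forall z, 0 <= f z)%R ->
  \int[mu \x mu]_(z in strip r) (f z)%:E =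
  \int[mu]_y \int[mu]_(x in cube y r) (f (x, y))%:E.
Proof.
move=> mf f0; rewrite integral_mkcond fubini_tonelli2/=.
- apply: eq_integral => x _; rewrite [RHS]integral_mkcond.
  apply: eq_integral => y _; rewrite !patchE; congr (if _ then _ else _).
- apply/measurable_restrict => //; first exact: measurable_strip.
  by apply: measurable_funTS; exact/measurable_EFinP.
- by move=> z; apply: erestrict_ge0 => y _; rewrite lee_fin.
Qed.

Lemma measurable_increment p u g : measurable_fun setT u -> measurable_fun setT g ->
  measurable_fun setT (fun z : V * V => `|u z.1 - g z.2| `^ p)%R.
Proof.
move=> mu' mg; apply: (measurableT_comp (measurable_powR _)).
apply: measurableT_comp => //; apply: measurable_funB; exact: measurableT_comp.
Qed.

(** This is Phi of the overview, taken with the sup norm. *)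
Definition near_energy p u r : \bar R :=
  \int[mu \x mu]_(z in strip r) (`|u z.1 - u z.2| `^ p)%:E.

Lemma near_energy_ge0 p u r : 0 <= near_energy p u r.
Proof. by rewrite /near_energy; apply: integral_ge0 => z _; rewrite lee_fin powR_ge0. Qed.

Lemma le_near_energy p u r r' : measurable_fun setT u -> (r <= r')%R ->
  near_energy p u r <= near_energy p u r'.
Proof.
move=> mu' rr'; apply: ge0_subset_integral => //; try exact: measurable_strip.
- apply: measurable_funTS; apply/measurable_EFinP; exact: measurable_increment.
- by move=> z /= /le_trans; apply.
Qed.

End strip_integrals.

(** * Truncation near the boundary and its cost *)

Section exterior_cubes.
Context {R : realType} {n : nat}.
Implicit Types (Omega : set 'rV[R]_n) (u : 'rV[R]_n -> R).
Local Notation mu := (lebesgue_rV n).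

(* Quantitative exterior density: a point within [4 t] of the complement sees a
   cube of the complement of comparable size at comparable distance. *)
Definition exterior_cubes Omega (c M t : R) := forall y y', Omega y -> ~ Omega y' ->
  `|y - y'| < 4 * t ->
  exists z, cube z (c * t) `<=` ~` Omega /\ cube z (c * t) `<=` cube y (M * t).

Definition core Omega t := [set y | forall y', ~ Omega y' -> 4 * t <= `|y - y'|].

(** By the triangle inequality the complement of the core is open, whatever [Omega] is. *)
Lemma measurable_core Omega t : measurable (core Omega t).
Proof.
rewrite -[core _ _]setCK; apply: measurableC; apply: open_measurable_rV.
rewrite openE => y /= /existsNP[y' /not_implyP[Oy' /negP]]; rewrite -ltNge => yy'.
apply/nbhs_ballP; exists (4 * t - `|y - y'|) => /=; first by rewrite subr_gt0.
move=> z; rewrite -ball_normE/= => yz /(_ y' Oy') h0.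
have := ler_distD y z y'; rewrite (distrC z y); lra.
Qed.

Definition truncate Omega t u y := u y * \1_(core Omega t) y.

Lemma measurable_truncate Omega t u : measurable_fun setT u ->
  measurable_fun setT (truncate Omega t u).
Proof.
by move=> mu'; apply: measurable_funM => //; apply: measurable_indic; exact: measurable_core.
Qed.

Lemma truncate_le Omega t u y : `|truncate Omega t u y| <= `|u y|.
Proof.
rewrite /truncate indicE; case: (_ \in _); rewrite ?mulr1// mulr0 normr0//.
Qed.

Local Open Scope ereal_scope.

(** Only points of [Omega] off the core contribute, and there the truncation error is [|u y|]. On
    the exterior cube [u] vanishes, so [|u z - u y| = |u y|], and integrating over it produces its
    volume. *)
Lemma boundary_layer_le Omega u (p c M t : R) y : (0 < p)%R -> (0 < c)%R -> (0 < t)%R ->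
  measurable_fun setT u -> (forall z, ~ Omega z -> u z = 0%R) ->
  exterior_cubes Omega c M t ->
  ((2 * (c * t)) ^+ n * `|u y - truncate Omega t u y| `^ p)%:E <=
  \int[mu]_(z in cube y (M * t)) (`|u z - u y| `^ p)%:E.
Proof.
move=> p0 c0 t0 mu' uO ext.
have I0 : 0 <= \int[mu]_(z in cube y (M * t)) (`|u z - u y| `^ p)%:E.
  by apply: integral_ge0 => z _; rewrite lee_fin powR_ge0.
rewrite /truncate indicE.
have [yS|yS] := pselect (core Omega t y).
  by rewrite mem_set// mulr1 subrr normr0 powR0 ?gt_eqF// mulr0.
rewrite memNset// mulr0 subr0.
have [Oy|Oy] := pselect (Omega y); last first.
  by rewrite {1}(uO y Oy) normr0 powR0 ?gt_eqF// mulr0.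
move: yS => /= /existsNP[y' /not_implyP[Oy' /negP]]; rewrite -ltNge => yy'.
have [z [zO zM]] := ext y y' Oy Oy' yy'.
apply: (@le_trans _ _ (\int[mu]_(z' in cube z (c * t)) (`|u z' - u y| `^ p)%:E)).
  rewrite (eq_integral (fun=> (`|u y| `^ p)%:E)); last first.
    by move=> z' /set_mem /zO /uO ->; rewrite sub0r normrN.
  rewrite integral_cst; last exact: measurable_cube.
  have ct0 : (0 <= c * t)%R by rewrite mulr_ge0// ltW.
  by rewrite [X in _ * X](lebesgue_rV_cube z ct0) -EFinM mulrC.
apply: ge0_subset_integral => //; try exact: measurable_cube.
apply: measurable_funTS; apply/measurable_EFinP.
apply: (measurableT_comp (measurable_powR _)).
by apply: measurableT_comp => //; apply: measurable_funB.
Qed.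

(** Triangle inequality through [u y]: the first part is a near energy, and the second depends on
    [y] only, so integrating out [x] gives the volume [(4 t)^n]. Writing [4 t = (2 / c) (2 c t)]
    matches it with the volume of the exterior cube in [boundary_layer_le]. *)
Lemma truncated_energy_le Omega u (p c M t : R) : (0 < p)%R -> (0 < c)%R ->
  (2 <= M)%R -> (0 < t)%R ->
  measurable_fun setT u -> (forall z, ~ Omega z -> u z = 0%R) ->
  exterior_cubes Omega c M t ->
  \int[mu]_x \int[mu]_(y in cube x (2 * t)) (`|u x - truncate Omega t u y| `^ p)%:E <=
  (2 `^ p * (1 + (2 / c) ^+ n))%:E * near_energy p u (M * t).
Proof.
move=> p0 c0 M2 t0 mu' uO ext; set g := truncate Omega t u.
have mg : measurable_fun setT g by exact: measurable_truncate.
rewrite -(@strip_integral1 _ _ (fun z => `|u z.1 - g z.2| `^ p)%R); last 2 first.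
- exact: measurable_increment.
- by move=> z; rewrite powR_ge0.
pose A := near_energy p u (2 * t).
pose h (z : 'rV[R]_n * 'rV[R]_n) : R := (`|u z.2 - g z.2| `^ p)%R.
have mh : measurable_fun setT (fun z : 'rV[R]_n * 'rV[R]_n => h z).
  apply: (measurableT_comp (measurable_powR _)); apply: measurableT_comp => //.
  by apply: measurable_funB; exact: measurableT_comp.
pose B := \int[mu \x mu]_(z in strip (2 * t)) (h z)%:E.
apply: (@le_trans _ _ ((2 `^ p)%:E * (A + B))).
  have mS := @measurable_strip R n (2 * t).
  have mF : measurable_fun (strip (2 * t)) (fun z : 'rV[R]_n * 'rV[R]_n =>
      (`|u z.1 - u z.2| `^ p)%:E).
    by apply: measurable_funTS; apply/measurable_EFinP; exact: measurable_increment.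
  have mH : measurable_fun (strip (2 * t)) (fun z => (h z)%:E).
    by apply: measurable_funTS; apply/measurable_EFinP.
  have h0 z : 0 <= (h z)%:E by rewrite lee_fin powR_ge0.
  rewrite /A /B /near_energy -ge0_integralD// -ge0_integralZl//; last 2 first.
  - exact: emeasurable_funD.
  - by move=> z _; rewrite adde_ge0// lee_fin powR_ge0.
  apply: ge0_le_integral_nomeas => z _; first by rewrite lee_fin powR_ge0.
  rewrite -EFinD -EFinM lee_fin; apply: le_trans (powRD_le p0 _ _) => //.
  apply: ge0_ler_powR; rewrite ?nnegrE ?addr_ge0 ?(ltW p0)//.
  exact: ler_distD.
have c20 : (0 <= (2 / c) ^+ n)%R by rewrite exprn_ge0// divr_ge0// ltW.
rewrite EFinM -muleA lee_wpmul2l ?lee_fin ?powR_ge0//.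
rewrite EFinD ge0_muleDl ?lee_fin// mul1e.
apply: leeD; first by apply: le_near_energy => //; rewrite ler_wpM2r// ltW.
rewrite /B strip_integral2//; last by move=> z; rewrite powR_ge0.
have mE : measurable_fun setT
    (fun z : 'rV[R]_n * 'rV[R]_n => `|u z.1 - u z.2| `^ p)%R.
  exact: measurable_increment.
rewrite /near_energy (strip_integral2 _ mE); last by move=> z; rewrite powR_ge0.
have mG : measurable_fun setT (fun y =>
    \int[mu]_(x in cube y (M * t)) (`|u x - u y| `^ p)%:E).
  under eq_fun do rewrite integral_mkcond.
  have := @measurable_fun_fubini_tonelli_G _ _ _ _ R mu
    ((fun z => (`|u z.1 - u z.2| `^ p)%:E) \_ (strip (M * t))).
  apply.
    apply/measurable_restrict => //; first exact: measurable_strip.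
    by apply: measurable_funTS; apply/measurable_EFinP.
  by move=> z; apply: erestrict_ge0 => y _; rewrite lee_fin powR_ge0.
rewrite -ge0_integralZl//; last first.
  by move=> y _; apply: integral_ge0 => z _; rewrite lee_fin powR_ge0.
apply: ge0_le_integral_nomeas => y _.
  by apply: integral_ge0 => z _; rewrite lee_fin powR_ge0.
rewrite /h /= integral_cst; last exact: measurable_cube.
have t20 : (0 <= 2 * t)%R by rewrite mulr_ge0// ltW.
rewrite [X in _ * X](lebesgue_rV_cube y t20).
have H := boundary_layer_le y p0 c0 t0 mu' uO ext.
rewrite -/g in H.
have ct : (0 < (2 * (c * t)) ^+ n)%R by rewrite exprn_gt0// !mulr_gt0.
apply: (@le_trans _ _ (((2 / c) ^+ n)%:E *
    ((2 * (c * t)) ^+ n * `|u y - g y| `^ p)%:E)).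
  have E : ((2 * (2 * t)) ^+ n = (2 / c) ^+ n * (2 * (c * t)) ^+ n)%R.
    by rewrite -exprMn; congr (_ ^+ _)%R; field; rewrite gt_eqF.
  by rewrite -!EFinM E lee_fin [leRHS]mulrA mulrC.
by rewrite lee_wpmul2l// lee_fin exprn_ge0// divr_ge0// ltW.
Qed.

End exterior_cubes.

(** * Test functions and the mollifier *)

Section C0infty_basic.
Context {R : realType} {n : nat}.
Implicit Types (Omega : set 'rV[R]_n.+1) (u : 'rV[R]_n.+1 -> R).

Lemma smooth_continuous u : smooth u -> continuous u.
Proof. by move=> /(_ [::])[]. Qed.

Lemma smooth_is_derive u j x : smooth u -> is_derive x (axis j) u (partial j u x).
Proof. by move=> /(_ [::])[_ /(_ j x) du]; exact/derivableP. Qed.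

Lemma smooth_partial_continuous u j : smooth u -> continuous (partial j u).
Proof. by move=> /(_ [:: j])[]. Qed.

Lemma C0infty_continuous Omega u : C0infty Omega u -> continuous u.
Proof. by move=> [/smooth_continuous]. Qed.

Lemma C0infty_measurable Omega u : C0infty Omega u -> measurable_fun setT u.
Proof. by move=> /C0infty_continuous; exact: continuous_measurable_rV. Qed.

Lemma C0infty_out Omega u x : C0infty Omega u -> ~ Omega x -> u x = 0.
Proof.
move=> [_ _ uO] Ox; apply: contrapT => /eqP ux; apply: Ox; apply: uO.
exact: subset_closure.
Qed.

Lemma C0infty_bounded Omega u : C0infty Omega u -> exists K r,
  [/\ 0 <= K, 0 <= r, forall x, `|u x| <= K & forall x, u x != 0 -> `|x| <= r].
Proof.
move=> [su cu _]; have cont := smooth_continuous su.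
have [r [_ Hr]] := compact_bounded cu.
have cuu : compact (u @` closure [set x | u x != 0]).
  by apply: continuous_compact => //; apply: continuous_subspaceT.
have [K [_ HK]] := compact_bounded cuu.
exists (`|K| + 1), (`|r| + 1); split; rewrite ?addr_ge0//.
- move=> x; have [->|ux] := eqVneq (u x) 0; first by rewrite normr0 addr_ge0.
  apply: (HK (`|K| + 1)); first by rewrite (le_lt_trans (ler_norm _))// ltrDl.
  by exists x => //; exact: subset_closure.
- move=> x ux; apply: (Hr (`|r| + 1)); first by rewrite (le_lt_trans (ler_norm _))// ltrDl.
  exact: subset_closure.
Qed.

Lemma integrable_bounded_supp (g : 'rV[R]_n -> R) (K r : R) : measurable_fun setT g ->
  0 <= r -> (forall x, `|g x| <= K) -> (forall x, g x != 0 -> `|x| <= r) ->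
  (lebesgue_rV n).-integrable setT (EFin \o g).
Proof.
move=> mg r0 gK gr; apply/integrableP; split; first exact/measurable_EFinP.
have K0 : 0 <= K by apply: le_trans (gK 0).
apply: (@le_lt_trans _ _ (\int[lebesgue_rV n]_(x in cube 0 r) (cst K%:E) x)%E).
  rewrite [leRHS]integral_mkcond; apply: ge0_le_integral_nomeas => // x _ /=.
  rewrite patchE; case: ifPn => [_|]; first by rewrite lee_fin.
  have [->|gx] := eqVneq (g x) 0; first by rewrite normr0.
  by rewrite notin_setE => -[]; rewrite /cube/= subr0; exact: gr.
rewrite integral_cst; last exact: measurable_cube.
by rewrite [X in (_ * X)%E](lebesgue_rV_cube 0 r0) -EFinM ltry.
Qed.

End C0infty_basic.

Section mollifier.
Context {R : realType} {n : nat}.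
Variable t : R.
Hypothesis t0 : 0 < t.
Local Notation mu := (lebesgue_rV n).

Definition bumps : 'I_n -> R -> R := fun _ => bump1 t.

Definition mollifier : 'rV[R]_n -> R := tensor bumps.

Lemma smooth_bumps : smooth_factors bumps.
Proof. by move=> i k; exact: bump1_bounded_derivatives. Qed.

Lemma mollifier_ge0 x : 0 <= mollifier x.
Proof. by apply: prodr_ge0 => i _; exact: bump1_ge0. Qed.

Lemma mollifier_le1 x : `|mollifier x| <= 1.
Proof.
rewrite ger0_norm ?mollifier_ge0//; apply: prodr_ile1 => i _.
by rewrite bump1_ge0 bump1_le1.
Qed.

Lemma mollifier_supp x : mollifier x != 0 -> `|x| <= t.
Proof.
move=> /prodf_neq0 H; apply: normr_rV_le => [|i]; first exact: ltW.
exact: (bump1_supp t0 (H i isT)).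
Qed.

Lemma mollifier_min x : `|x| <= t / 2 -> bump_min ^+ n <= mollifier x.
Proof.
move=> xt; rewrite -[X in _ ^+ X]card_ord -prodr_const; apply: ler_prod => i _.
rewrite ltW ?bump_min_gt0//= bump1_min//.
exact: le_trans (coord_le_normr _ _) xt.
Qed.

Lemma measurable_mollifierB (x : 'rV[R]_n) :
  measurable_fun setT (fun y : 'rV[R]_n => mollifier (x - y)).
Proof. apply: measurable_tensorB; exact: smooth_bumps. Qed.

Lemma integrable_mollifierB (x : 'rV[R]_n) :
  mu.-integrable setT (EFin \o (fun y : 'rV[R]_n => mollifier (x - y))).
Proof.
apply: (@integrable_bounded_supp _ _ _ 1 (`|x| + t)).
- exact: measurable_mollifierB.
- by rewrite addr_ge0// ltW.
- by move=> y; exact: mollifier_le1.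
- move=> y /mollifier_supp xy; have := ler_normB x (x - y); rewrite opprB addrC subrK; lra.
Qed.

(** The argument is [0 - y] so that every [mollifier (x - y)] is a translate of the integrand;
    reflection invariance of the measure is then not involved. *)
Definition mass : R := \int[mu]_y mollifier (0 - y).

Lemma mass_translation (x : 'rV[R]_n) : \int[mu]_y mollifier (x - y) = mass.
Proof.
pose f (y : 'rV[R]_n) := (mollifier (0 - y))%:E.
suff E : (\int[mu]_y (mollifier (x - y))%:E = \int[mu]_y f y)%E.
  by rewrite /Rintegral E.
rewrite -(@integral_rV_translation R n f (- x)).
- by apply: eq_integral => y _; rewrite /f sub0r opprB.
- apply/measurable_EFinP; exact: measurable_mollifierB.
- by move=> y; rewrite lee_fin mollifier_ge0.
Qed.

(** On the cube of side [t] about 0 each of the [n] factors is at least [bump_min]. This bounds the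
    normalising factor [1 / mass] by a multiple of [t^(-n)]. *)
Lemma mass_ge : (bump_min * t) ^+ n <= mass.
Proof.
have t20 : 0 <= t / 2 by rewrite divr_ge0// ltW.
rewrite -lee_fin /mass fineK; last first.
  exact: (integrable_fin_num measurableT (integrable_mollifierB 0)).
apply: (@le_trans _ _ (\int[mu]_(x in cube 0 (t / 2)) (cst (bump_min ^+ n)%:E) x)%E).
  rewrite integral_cst; last exact: measurable_cube.
  rewrite [X in (_ * X)%E](lebesgue_rV_cube 0 t20) -EFinM -exprMn lee_fin.
  by rewrite (_ : 2 * (t / 2) = t)//; field.
rewrite [leLHS]integral_mkcond; apply: ge0_le_integral_nomeas => x _; rewrite patchE.
  by case: ifPn => // _; rewrite lee_fin exprn_ge0// ltW// bump_min_gt0.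
case: ifPn => [|_]; last by rewrite lee_fin mollifier_ge0.
rewrite inE /cube/= subr0 => xt.
by rewrite lee_fin mollifier_min// sub0r normrN.
Qed.

Lemma mass_gt0 : 0 < mass.
Proof.
apply: lt_le_trans mass_ge; rewrite exprn_gt0// mulr_gt0//; exact: bump_min_gt0.
Qed.

End mollifier.

(** The factors that do not move lie between 0 and 1, so the one-variable [K] works in every
    dimension and at every scale. *)
Lemma mollifier_axis_lipschitz {R : realType} : exists2 K : R, 0 <= K &
  forall n (t : R) (j : 'I_n) s x, 0 < t ->
  `|mollifier t (s *: axis j + x) - mollifier t x| <= K / t * `|s|.
Proof.
have [K K0 HK] := @bump1_lipschitz R; exists K => // n t j s x t0.
rewrite /mollifier tensor_axis (tensorE _ j) -mulrBl normrM.
rewrite -[leRHS]mulr1 ler_pM//.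
  have := HK t (x ord0 j + s) (x ord0 j) t0.
  by rewrite [x ord0 j + s - _]addrAC subrr add0r.
rewrite normr_prod; apply: prodr_ile1 => i _.
by rewrite normr_ge0/= ger0_norm ?bump1_ge0 ?bump1_le1.
Qed.

(** Only increments with [|h| <= t] are tested: for those a mollifier of scale [t] shifted by [h]
    keeps its support in the cube of radius [2 t]. *)
Lemma is_derive_le {R : realType} (V : normedModType R) (f : V -> R) (x v : V) (d C t : R) :
  is_derive x v f d -> 0 < t ->
  (forall h, `|h| <= t -> `|f (h *: v + x) - f x| <= C * `|h|) -> `|d| <= C.
Proof.
move=> fd t0 H.
have L : h^-1 *: (f (h *: v + x) - f x) @[h --> 0^'] --> d.
  by have [df <-] := fd; exact: df.
apply/ler_addgt0Pr => e e0; move/cvgrPdist_lt : L => /(_ e e0) /= L.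
near (0 : R)^' => h.
have h0 : h != 0 by near: h; exact: nbhs_dnbhs_neq.
have hL : `|d - h^-1 *: (f (h *: v + x) - f x)| < e by near: h.
have ht : `|h| <= t by apply: ltW; near: h; exact: dnbhs0_lt.
have hq : `|h^-1 *: (f (h *: v + x) - f x)| <= C.
  by rewrite normrM normfV mulrC ler_pdivrMr ?normr_gt0// H.
rewrite -[d](subrK (h^-1 *: (f (h *: v + x) - f x))).
by rewrite (le_trans (ler_normD _ _))// addrC lerD// ltW.
Unshelve. all: by end_near. Qed.

(** * The mollified truncation as a competitor in the K-functional *)

Section approximation.
Context {R : realType} {n : nat}.
Local Notation N := n.+1.
Local Notation mu := (lebesgue_rV N).
Variables (Omega : set 'rV[R]_N) (u : 'rV[R]_N -> R) (t : R).
Hypotheses (t0 : 0 < t) (uC : C0infty Omega u).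

Let g := truncate Omega t u.
Let Z : R := mass (n := N) t.

Let mu_ : measurable_fun setT u. Proof. exact: C0infty_measurable uC. Qed.

Let mg : measurable_fun setT g. Proof. exact: measurable_truncate. Qed.

Let Z0 : 0 < Z. Proof. exact: mass_gt0. Qed.

Let ig : mu.-integrable setT (EFin \o g).
Proof.
have [K [r [K0 r0 uK ur]]] := C0infty_bounded uC.
apply: (integrable_bounded_supp (K := K) mg r0) => x.
  exact: le_trans (truncate_le _ _ _ _) (uK x).
by rewrite /g /truncate mulf_eq0 negb_or => /andP[/ur].
Qed.

(** The normalisation sits on [g] and not on the kernel, so that the kernel remains a product of
    bumps. *)
Definition mollified : 'rV[R]_N -> R := conv (fun y => Z^-1 * g y) (bumps t).

Let ig' : mu.-integrable setT (EFin \o (fun y => Z^-1 * g y)).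
Proof. exact: (@integrableZl _ _ _ mu setT measurableT Z^-1 (EFin \o g)). Qed.

Lemma mollifiedE x : mollified x = Z^-1 * \int[mu]_y (mollifier t (x - y) * g y).
Proof.
rewrite -RintegralZl//; last exact: (integrable_conv ig x (smooth_bumps t)).
by apply: eq_Rintegral => y _; rewrite mulrCA.
Qed.

Lemma mollified_smooth : smooth mollified.
Proof. exact: conv_smooth ig' (smooth_bumps t). Qed.

Lemma mollified_neq0 x : mollified x != 0 ->
  exists y, [/\ u y != 0, core Omega t y & `|x - y| <= t].
Proof.
move=> vx; apply: contrapT => H; move/eqP: vx; apply.
rewrite mollifiedE (_ : (\int[mu]_y _)%R = 0) ?mulr0//.
rewrite /Rintegral integral0_eq// => y _.
have [->|rxy] := eqVneq (mollifier t (x - y)) 0; first by rewrite mul0r.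
have [->|gy] := eqVneq (g y) 0; first by rewrite mulr0.
exfalso; apply: H; exists y; move: gy; rewrite /g /truncate mulf_eq0 negb_or => /andP[uy].
rewrite indicE; case: (boolP (y \in _)) => [|_]; last by rewrite eqxx.
by rewrite inE => cy _; split => //; exact: mollifier_supp rxy.
Qed.

(** Mollifying moves the support by at most [t] away from the core, and passing to the closure by at
    most another [t]; since [2 t < 4 t], the support stays inside [Omega]. *)
Lemma mollified_C0infty : C0infty Omega mollified.
Proof.
have [K [r [_ r0 _ ur]]] := C0infty_bounded uC.
have near_core x : closure [set x | mollified x != 0] x ->
    exists y, [/\ u y != 0, core Omega t y & `|x - y| <= 2 * t].
  have bt : nbhs x (ball x t) by exact: nbhsx_ballx.
  move=> /(_ _ bt)[z [/= vz]].
  have [y [uy cy zy]] := mollified_neq0 vz.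
  rewrite -ball_normE/= => xz; exists y; split => //.
  have := ler_distD z x y; lra.
split; first exact: mollified_smooth.
- apply: bounded_closed_compact; last exact: closed_closure.
  exists (r + 2 * t); split; first exact: num_real.
  move=> M rM x /near_core[y [/ur yr _ xy]].
  rewrite /= -[x](subrK y) (le_trans (ler_normD _ _))//; lra.
- move=> x /near_core[y [_ cy xy]]; apply: contrapT => /cy.
  rewrite distrC => h; move: t0; lra.
Qed.

(** The radius is [2 t], twice that of the mollifier, so that one quantity controls both the kernel
    and its increments by [|h| <= t]. *)
Definition deviation_fun x y := (u x - g y) * \1_(cube x (2 * t)) y.

Definition deviation x : R := \int[mu]_y `|deviation_fun x y|.

Let mw x : measurable_fun setT (deviation_fun x).
Proof.
apply: measurable_funM; last by apply: measurable_indic; exact: measurable_cube.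
exact: measurable_funB.
Qed.

Let iw x : mu.-integrable setT (EFin \o deviation_fun x).
Proof.
have [K [r [K0 r0 uK ur]]] := C0infty_bounded uC.
apply: (integrable_bounded_supp (K := K + K) (r := `|x| + 2 * t)) => //.
- by rewrite addr_ge0// mulr_ge0// ltW.
- move=> y; rewrite normrM -[leRHS]mulr1 ler_pM//.
    rewrite (le_trans (ler_normB _ _))// lerD//.
    exact: le_trans (truncate_le _ _ _ _) (uK y).
  by rewrite indicE; case: (_ \in _); rewrite ?normr1// normr0.
- move=> y; rewrite mulf_eq0 negb_or indicE => /andP[_].
  case: (boolP (y \in _)) => [|_]; last by rewrite eqxx.
  rewrite inE /cube/= => yx _; rewrite -[y](subrK x) (le_trans (ler_normD _ _))//; lra.
Qed.

Lemma deviation_ge0 x : 0 <= deviation x.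
Proof. by apply: Rintegral_ge0. Qed.

(** Serves twice: with [phi] the mollifier it bounds [u] minus its mollification, and with [phi] an
    increment of the mollifier, of integral 0, it bounds the partial derivatives. *)
Lemma weighted_deviation_le x (phi : 'rV[R]_N -> R) (K : R) : measurable_fun setT phi ->
  (forall y, `|phi y| <= K) -> (forall y, phi y != 0 -> `|y - x| <= 2 * t) ->
  mu.-integrable setT (EFin \o phi) ->
  `|u x * \int[mu]_y phi y - \int[mu]_y (phi y * g y)| <= K * deviation x.
Proof.
move=> mphi phiK phix iphi.
rewrite -RintegralZl// -RintegralB//; last 2 first.
- exact: (@integrableZl _ _ _ mu setT measurableT (u x) (EFin \o phi)).
- exact: integrable_boundedM ig _ _ mphi phiK.
rewrite (_ : (\int[mu]_y _)%R = \int[mu]_y (phi y * deviation_fun x y)).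
  exact: Rintegral_boundedM_le.
apply: eq_Rintegral => y _.
have [->|py] := eqVneq (phi y) 0; first by rewrite mulr0 !mul0r subr0.
rewrite /deviation_fun indicE mem_set; last exact: phix.
by rewrite mulr1 mulrBr (mulrC (u x)).
Qed.

Lemma mollified_approx_le x : `|u x - mollified x| <= Z^-1 * deviation x.
Proof.
rewrite mollifiedE -[u x](mulfK (lt0r_neq0 Z0)) (mulrC _ Z^-1) -mulrBr normrM.
rewrite gtr0_norm ?invr_gt0// ler_wpM2l ?invr_ge0 ?(ltW Z0)//.
rewrite /Z -(mass_translation t x) -[leRHS]mul1r; apply: weighted_deviation_le.
- exact: measurable_mollifierB.
- by move=> y; exact: mollifier_le1.
- by move=> y /(mollifier_supp t0); rewrite distrC; move: t0; lra.
- exact: integrable_mollifierB.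
Qed.

Variable K : R.
Hypothesis K0 : 0 <= K.
Hypothesis lipK : forall n (t : R) (j : 'I_n) s x, 0 < t ->
  `|mollifier t (s *: axis j + x) - mollifier t x| <= K / t * `|s|.

(* The mass of the mollifier is translation invariant, so its increments
   integrate to 0 and [u x] may be subtracted from [g]. *)
Lemma mollified_partial_le j x : `|partial j mollified x| <= Z^-1 * (K / t) * deviation x.
Proof.
apply: (is_derive_le (smooth_is_derive j x mollified_smooth) t0) => h ht.
rewrite !mollifiedE -mulrBr normrM gtr0_norm ?invr_gt0// -!mulrA.
rewrite ler_wpM2l ?invr_ge0 ?(ltW Z0)//.
have iM z := integrable_conv ig z (smooth_bumps t).
rewrite -RintegralB//; try exact: iM.
pose phi y := mollifier t (h *: axis j + x - y) - mollifier t (x - y).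
have iphi : mu.-integrable setT (EFin \o phi).
  exact: (@integrableB _ _ _ mu setT measurableT _ _ (integrable_mollifierB t0 _)
    (integrable_mollifierB t0 _)).
have phi0 : \int[mu]_y phi y = 0.
  by rewrite RintegralB//; try exact: integrable_mollifierB; rewrite !mass_translation// subrr.
have := @weighted_deviation_le x phi (K / t * `|h|).
rewrite phi0 mulr0 sub0r normrN.
rewrite (_ : K * (t^-1 * (deviation x * `|h|)) = K / t * `|h| * deviation x); last by ring.
rewrite (_ : (\int[mu]_y (phi y * g y))%R = \int[mu]_y
    (mollifier t (h *: axis j + x - y) * g y - mollifier t (x - y) * g y)); last first.
  by apply: eq_Rintegral => y _; rewrite mulrBl.
apply => //.
- by apply: measurable_funB; exact: measurable_mollifierB.
- by move=> y; rewrite /phi -addrA; exact: lipK.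
- move=> y; rewrite /phi => py.
  (* At least one of the two kernels is nonzero at [y]; either way [y] is within [t + |h| <= 2 t] of
     [x]. *)
  have [|/(mollifier_supp t0)] := eqVneq (mollifier t (x - y)) 0; last first.
    by rewrite distrC; move: t0; lra.
  move=> e; move: py; rewrite e subr0 => /(mollifier_supp t0) xy.
  have ha : `|h *: axis j| <= t := le_trans (normr_axis j h) ht.
  rewrite distrC -[x - y](addKr (h *: axis j)) addrC addrA.
  rewrite (le_trans (ler_normB _ _))//; lra.
Qed.

Lemma mollified_grad_le x :
  enorm (grad mollified x) <= Z^-1 * (N%:R * (K / t)) * deviation x.
Proof.
apply: (le_trans (enorm_le_normr _)).
rewrite (_ : Z^-1 * _ * _ = N%:R * (Z^-1 * (K / t) * deviation x)); last by ring.
apply: ler_wpM2l => //; apply: normr_rV_le => [|i].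
  by rewrite !mulr_ge0 ?invr_ge0 ?deviation_ge0// ltW.
by rewrite mxE; exact: mollified_partial_le.
Qed.

End approximation.

Lemma Kfunctional_ge0 {R : realType} {n : nat} (Omega : set 'rV[R]_n.+1) p t u :
  0 <= t -> (0 <= Kfunctional Omega p t u)%E.
Proof.
move=> t0; apply: le_ereal_inf_tmp => _ [w _ <-].
by rewrite adde_ge0 ?mule_ge0 ?poweR_ge0.
Qed.

(** * Upper bound of the K-functional by the near energy *)

Section K_bound.
Context {R : realType} {n : nat}.
Local Notation N := n.+1.
Local Notation mu := (lebesgue_rV N).
Variables (Omega : set 'rV[R]_N) (u : 'rV[R]_N -> R) (p c M t : R).
Hypotheses (p1 : 1 < p) (c0 : 0 < c) (M2 : 2 <= M) (t0 : 0 < t).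
Hypotheses (uC : C0infty Omega u) (ext : exterior_cubes Omega c M t).
Local Open Scope ereal_scope.

Let p0 : (0 < p)%R. Proof. by move: p1; lra. Qed.

Let mu_ : measurable_fun setT u. Proof. exact: C0infty_measurable uC. Qed.

Let g := truncate Omega t u.

Let mg : measurable_fun setT g. Proof. exact: measurable_truncate. Qed.

Let t20 : (0 <= 2 * t)%R. Proof. by rewrite mulr_ge0// ltW. Qed.

(** The factor produced by Jensen on a cube of radius [2 t]. *)
Let J := (((2 * (2 * t)) ^+ N) `^ (p - 1))%R.

Lemma deviation_powR_le x : (deviation Omega u t x `^ p)%:E <=
  J%:E * \int[mu]_(y in cube x (2 * t)) (`|u x - g y| `^ p)%:E.
Proof.
have mf : measurable_fun setT (fun y => `|u x - g y|%R).
  by apply: measurableT_comp => //; exact: measurable_funB.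
have D0 : 0 <= \int[mu]_(y in cube x (2 * t)) (`|u x - g y|)%:E.
  by apply: integral_ge0.
apply: le_trans (jensen_powR p1 (measurable_cube x (2 * t)) (lebesgue_rV_cube x t20) mf
  (fun y => normr_ge0 _)).
rewrite -poweR_EFin; apply: lee_poweR; first exact: ltW.
  by rewrite lee_fin deviation_ge0.
rewrite /deviation /Rintegral.
have -> : \int[mu]_y (`|deviation_fun Omega u t x y|)%:E =
    \int[mu]_(y in cube x (2 * t)) (`|u x - g y|)%:E.
  rewrite [RHS]integral_mkcond; apply: eq_integral => y _.
  rewrite patchE /deviation_fun indicE; case: (_ \in _); first by rewrite mulr1.
  by rewrite mulr0 normr0.
(* [deviation] is the [fine] part of this integral: it equals the integral if finite, and is 0 if
   the integral is infinite, so the inequality holds in both cases. *)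
by move: D0; case: (integral _ _ _) => [r||]//= _; rewrite leey.
Qed.

Let q := (2 `^ p * (1 + (2 / c) ^+ N))%R.

Let q0 : (0 < q)%R.
Proof. by rewrite mulr_gt0 ?powR_gt0// ltr_pwDl// exprn_ge0// divr_ge0// ltW. Qed.

Let B := J%:E * (q%:E * near_energy p u (M * t)).

Let B0 : 0 <= B.
Proof.
rewrite /B !mule_ge0 ?near_energy_ge0 ?lee_fin ?powR_ge0//; exact: ltW.
Qed.

(** After Jensen at each [x], the integral over [Omega] is enlarged to the whole space, where it is
    the double integral bounded by [truncated_energy_le]. *)
Lemma integral_powR_deviation_le (f : 'rV[R]_N -> R) (A : R) : (0 <= A)%R ->
  (forall x, `|f x| <= A * deviation Omega u t x)%R ->
  \int[mu]_(x in Omega) (`|f x| `^ p)%:E <= (A `^ p)%:E * B.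
Proof.
move=> A0 fA; pose G x := \int[mu]_(y in cube x (2 * t)) (`|u x - g y| `^ p)%:E.
have G0 x : 0 <= G x by apply: integral_ge0 => y _; rewrite lee_fin powR_ge0.
have mG : measurable_fun setT G.
  rewrite (_ : G = (fun x => \int[mu]_y
      ((fun y => (`|u x - g y| `^ p)%:E) \_ (cube x (2 * t))) y)); last first.
    by apply/funext => x; rewrite /G integral_mkcond.
  have := @measurable_fun_fubini_tonelli_F _ _ _ _ R mu
    ((fun z => (`|u z.1 - g z.2| `^ p)%:E) \_ (strip (2 * t))).
  rewrite (_ : fubini_F _ _ = (fun x => \int[mu]_y
      ((fun y => (`|u x - g y| `^ p)%:E) \_ (cube x (2 * t))) y)).
    apply.
      apply/measurable_restrict => //; first exact: measurable_strip.
      by apply: measurable_funTS; apply/measurable_EFinP; exact: measurable_increment.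
    by move=> z; apply: erestrict_ge0 => y _; rewrite lee_fin powR_ge0.
  apply/funext => x; apply: eq_integral => y _; rewrite !patchE.
  congr (if _ then _ else _).
  by apply/idP/idP; rewrite !inE /cube/strip/= distrC.
apply: (@le_trans _ _ (\int[mu]_x ((A `^ p * J)%:E * G x))).
  rewrite integral_mkcond; apply: ge0_le_integral_nomeas => x _; rewrite patchE.
    by case: ifPn => // _; rewrite lee_fin powR_ge0.
  case: ifPn => [_|_]; last by rewrite mule_ge0// lee_fin mulr_ge0 ?powR_ge0.
  apply: (@le_trans _ _ ((A `^ p)%:E * (deviation Omega u t x `^ p)%:E)).
    rewrite -EFinM lee_fin -powRM ?deviation_ge0//.
    by apply: ge0_ler_powR; rewrite ?nnegrE ?mulr_ge0 ?deviation_ge0 ?(ltW p0).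
  rewrite EFinM -muleA lee_wpmul2l ?lee_fin ?powR_ge0//.
  exact: deviation_powR_le.
rewrite ge0_integralZl//; last by rewrite lee_fin mulr_ge0 ?powR_ge0.
rewrite EFinM -muleA lee_wpmul2l ?lee_fin ?powR_ge0//.
rewrite /B lee_wpmul2l ?lee_fin ?powR_ge0//.
apply: truncated_energy_le => // z; exact: C0infty_out uC.
Qed.

Lemma Lpnorm_deviation_le (f : 'rV[R]_N -> R) (A : R) : (0 <= A)%R ->
  (forall x, `|f x| <= A * deviation Omega u t x)%R ->
  Lpnorm Omega p f <= A%:E * B `^ p^-1.
Proof.
move=> A0 fA; rewrite /Lpnorm.
have -> : A%:E = (A `^ p)%:E `^ p^-1.
  by rewrite poweR_EFin -powRrM mulfV ?gt_eqF// powRr1.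
rewrite -poweRM ?lee_fin ?powR_ge0//.
apply: lee_poweR; first by rewrite invr_ge0 ltW.
  by apply: integral_ge0 => x _; rewrite lee_fin powR_ge0.
exact: integral_powR_deviation_le.
Qed.

Variable K : R.
Hypothesis K0 : (0 <= K)%R.
Hypothesis lipK : forall n (t : R) (j : 'I_n) s x, (0 < t)%R ->
  (`|mollifier t (s *: axis j + x) - mollifier t x| <= K / t * `|s|)%R.

(** Its factors come from [mass_ge] together with the value and gradient bounds ([1] and [N K]),
    from Jensen on a cube of volume [(4 t)^N], and from [truncated_energy_le]. The powers of [t]
    combine as [t^(-N p) t^(N (p-1)) = t^(-N)]. *)
Definition mollification_const (n' : nat) (p' K' c' : R) : R :=
  ((bump_min ^+ n')^-1 * (1 + n'%:R * K')) `^ p' * (4 ^+ n') `^ (p' - 1) *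
  (2 `^ p' * (1 + (2 / c') ^+ n')).

Lemma Kfunctional_le_near_energy : Kfunctional Omega p t u `^ p <=
  (mollification_const N p K c / t ^+ N)%:E * near_energy p u (M * t).
Proof.
pose Z : R := mass (n := N) t.
have Z0 : (0 < Z)%R by exact: mass_gt0.
pose v := mollified Omega u t.
pose A1 := (Z^-1)%R; pose A2 := (Z^-1 * (N%:R * (K / t)))%R.
have A10 : (0 <= A1)%R by rewrite invr_ge0 ltW.
have A20 : (0 <= A2)%R by rewrite mulr_ge0// mulr_ge0// divr_ge0// ltW.
have tA2 : (0 <= t * A2)%R by rewrite mulr_ge0// ltW.
have KAB : Kfunctional Omega p t u <= (A1 + t * A2)%:E * B `^ p^-1.
  apply: (@le_trans _ _ (Lpnorm Omega p (u \- v)%R +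
      t%:E * Lpnorm Omega p (fun x => enorm (grad v x)))).
    by apply: ereal_inf_lbound; exists v => //; exact: mollified_C0infty.
  rewrite EFinD ge0_muleDl ?lee_fin//.
  apply: leeD; first exact: (Lpnorm_deviation_le A10 (mollified_approx_le t0 uC)).
  rewrite EFinM -muleA lee_wpmul2l ?lee_fin ?(ltW t0)//.
  apply: (Lpnorm_deviation_le A20) => x.
  by rewrite ger0_norm ?sqrtr_ge0//; exact: mollified_grad_le.
have Kf0 : 0 <= Kfunctional Omega p t u.
  by apply: Kfunctional_ge0; exact: ltW.
have A0 : (0 <= A1 + t * A2)%R by rewrite addr_ge0// mulr_ge0// ltW.
apply: (le_trans (lee_poweR (ltW p0) Kf0 KAB)).
rewrite poweRM ?poweR_ge0 ?lee_fin// poweR_invK ?gt_eqF//.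
rewrite poweR_EFin /B !muleA -!EFinM lee_wpmul2r ?near_energy_ge0//.
rewrite lee_fin /mollification_const -/q [leRHS]mulrAC ler_pM2r//.
have T0 : (0 < t ^+ N)%R by rewrite exprn_gt0.
have b0 : (0 < bump_min ^+ N :> R)%R by rewrite exprn_gt0// bump_min_gt0.
have -> : (A1 + t * A2 = Z^-1 * (1 + N%:R * K))%R.
  by rewrite /A1 /A2; field; rewrite !gt_eqF.
have NK0 : (0 <= 1 + N%:R * K)%R by rewrite addr_ge0// mulr_ge0.
have ZT : (Z^-1 <= (bump_min ^+ N)^-1 * (t ^+ N)^-1)%R.
  by rewrite -invfM lef_pV2 ?posrE ?mulr_gt0// -exprMn mass_ge.
apply: (@le_trans _ _ (((bump_min ^+ N)^-1 * (t ^+ N)^-1 * (1 + N%:R * K)) `^ p * J)%R).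
  rewrite ler_wpM2r ?powR_ge0//; apply: ge0_ler_powR; rewrite ?(ltW p0)//.
  - by rewrite nnegrE mulr_ge0// invr_ge0 ltW.
  - by rewrite nnegrE !mulr_ge0// invr_ge0 ltW.
  - by rewrite ler_wpM2r.
rewrite mulrAC powRM ?mulr_ge0 ?invr_ge0 ?(ltW b0) ?(ltW T0)//.
rewrite /J (_ : (2 * (2 * t)) ^+ N = 4 ^+ N * t ^+ N)%R; last first.
  by rewrite -exprMn; congr (_ ^+ _)%R; ring.
rewrite powRM ?exprn_ge0 ?(ltW t0)//.
have -> : ((t ^+ N)^-1 `^ p = (t ^+ N)^-1 * ((t ^+ N) `^ (p - 1))^-1)%R.
  rewrite -powRN -[in RHS](powR_inv1 (ltW T0)) -powRD; last first.
    by apply/implyP => _; rewrite gt_eqF.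
  by rewrite -(powR_inv1 (ltW T0)) -powRrM; congr (_ `^ _)%R; ring.
rewrite le_eqVlt; apply/orP; left; apply/eqP.
by field; rewrite !gt_eqF ?powR_gt0.
Qed.

End K_bound.

Lemma continuous_line {R : realType} (V : normedModType R) (y w : V) :
  continuous (fun s : R => y + s *: w).
Proof.
by move=> s; apply: cvgD; [exact: cvg_cst|apply: cvgZr_tmp; exact: cvg_id].
Qed.

(** * Exterior cubes of Lipschitz domains *)

Section exterior_geometry.
Context {R : realType}.

Lemma enorm_ge0 m (x : 'rV[R]_m) : 0 <= enorm x.
Proof. exact: sqrtr_ge0. Qed.

Lemma enorm_mulmx m (A : 'M[R]_m) (x : 'rV[R]_m) :
  A *m A^T = 1%:M -> enorm (x *m A) = enorm x.
Proof.
have E (y : 'rV[R]_m) : \sum_i y ord0 i ^+ 2 = (y *m y^T) ord0 ord0.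
  by rewrite mxE; apply: eq_bigr => i _; rewrite mxE expr2.
by move=> AA; rewrite /enorm !E trmx_mul mulmxA -(mulmxA x) AA mulmx1.
Qed.

Lemma enorm_col'_le m (x : 'rV[R]_m.+1) : enorm (col' ord0 x : 'rV[R]_m) <= enorm x.
Proof.
rewrite /enorm ler_wsqrtr// [leRHS]big_ord_recl.
under eq_bigr do rewrite mxE.
by rewrite lerDr sqr_ge0.
Qed.

Lemma enorm_delta m (j : 'I_m) (s : R) : enorm (s *: axis j) = `|s|.
Proof.
rewrite /enorm (bigD1 j)//= big1 => [|i /negbTE ij].
  by rewrite /axis !mxE !eqxx mulr1 addr0 sqrtr_sqr.
by rewrite /axis !mxE ij eqxx mulr0 expr0n.
Qed.

Context {n : nat}.
Local Notation N := n.+1.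
Implicit Types (Omega : set 'rV[R]_N).

(** If the segment missed the boundary, its trace on [Omega] would be nonempty, open and closed in
    it, hence all of it by connectedness, although [y'] lies outside. *)
Lemma segment_meets_boundary Omega y y' : open Omega -> Omega y -> ~ Omega y' ->
  exists2 x, boundary Omega x & `|x - y| <= `|y' - y|.
Proof.
move=> oO Oy Oy'; pose f (s : R) : 'rV[R]_N := y + s *: (y' - y).
pose A := f @` `[0, 1]%classic.
have cA : connected A.
  apply: connected_continuous_connected; first exact: segment_connected.
  by apply: continuous_subspaceT; exact: continuous_line.
have yA : A y by exists 0; rewrite /= ?in_itv/= ?lexx ?ler01// /f scale0r addr0.
have y'A : A y'.
  by exists 1; rewrite /= ?in_itv/= ?lexx ?ler01// /f scale1r addrC subrK.
apply: contrapT => noB.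
have AO x : A x -> closure Omega x -> Omega x.
  move=> [s]; rewrite /= in_itv/= => /andP[s0 s1] <- cOx; apply: contrapT => Ox; apply: noB.
  exists (f s).
    split => //; have /interior_id -> : open Omega by []; exact: Ox.
  rewrite /f addrAC subrr add0r normrZ ger0_norm//.
  by rewrite ler_piMl.
have /seteqP[_] : A `&` Omega = A.
  apply: cA.
  - by exists y.
  - by exists Omega.
  - exists (closure Omega); first exact: closed_closure.
    apply/seteqP; split => x [Ax Ox]; split => //; first exact: subset_closure.
    exact: AO.
by move=> /(_ y' y'A)[_].
Qed.

Lemma enorm_le_diam Omega y z : bounded_set Omega -> Omega y -> Omega z ->
  enorm (y - z) <= diam Omega.
Proof.
move=> [M [_ OM]] Oy Oz; apply: sup_ubound; last by exists (y, z).
exists (N%:R * ((`|M| + 1) + (`|M| + 1))) => _ [[a b] /= [Oa Ob] <-].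
have MM : M < `|M| + 1 by rewrite (le_lt_trans (ler_norm _))// ltrDl.
apply: (le_trans (enorm_le_normr _)); rewrite ler_wpM2l//.
by rewrite (le_trans (ler_normB _ _))// lerD//; exact: (OM _ MM).
Qed.

(** Chosen so that [N c (1 + L) = 1] for [L >= 0]; the absolute value keeps it positive for every
    real [L]. *)
Definition cube_radius (m : nat) (L : R) : R := (m%:R * (1 + `|L|))^-1.

(** The 6 is [2 + 4]: from the cube to a boundary point, then to [y]. The quotient covers scales
    [t >= r / (2 N)], where [d <= (2 N d / r) t]. *)
Definition cube_distance (m : nat) (d r : R) : R := 6 + 2 * m%:R * `|d| / `|r|.

Lemma cube_radius_gt0 L : 0 < cube_radius N L.
Proof. by rewrite invr_gt0 mulr_gt0// ltr_pwDl. Qed.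

Lemma cube_distance_ge m d r : 6 <= cube_distance m d r.
Proof. by rewrite lerDl !mulr_ge0// invr_ge0. Qed.

(** At small scales the cube is centred at depth [t] below a boundary point in its chart. A
    displacement of Euclidean length at most [N c t] changes height minus graph by at most
    [(1 + L) N c t = t], so the cube stays on or below the graph. *)
Lemma lipschitz_exterior_cubes Omega L r t : open Omega -> bounded_set Omega ->
  lipschitz_character Omega L r -> 0 < t ->
  exterior_cubes Omega (cube_radius N L) (cube_distance N (diam Omega) r) t.
Proof.
move=> oO bO [L0 r0 chart] t0 y y' Oy Oy' yy'.
have N0 : (0 : R) < N%:R by rewrite ltr0n.
have N1 : (1 : R) <= N%:R by rewrite ler1n.
set c := cube_radius N L; set M := cube_distance _ _ _.
have c0 : 0 < c by exact: cube_radius_gt0.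
have cN : N%:R * c * (1 + L) = 1.
  by rewrite /c /cube_radius ger0_norm//; field; rewrite !gt_eqF// ltr_pwDl.
have Nc : N%:R * c <= 1.
  by rewrite -[leRHS]cN ler_peMr ?lerDl// mulr_ge0// ltW.
have c1 : c <= 1 by apply: le_trans Nc; rewrite ler_peMl// ltW.
have ct : c * t <= t by rewrite ler_piMl// ltW.
(* At scales [t >= r / (2 N)] a cube farther than the diameter will do; at
   smaller scales it is found along the exterior axis of a chart. *)
have [tr|tr] := ltP (2 * N%:R * t) r; last first.
  pose d := diam Omega.
  have d0 : 0 <= d by apply: le_trans (enorm_le_diam bO Oy Oy); exact: enorm_ge0.
  (* Since [c <= 1], the first coordinate of every point of this cube exceeds that of [y] by at
     least [d + t], more than the diameter. *)
  exists ((d + 2 * t) *: axis ord0 + y); split => z /= zz0.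
    move=> Oz; have := le_trans (normr_le_enorm _) (enorm_le_diam bO Oz Oy).
    have := coord_le_normr (z - ((d + 2 * t) *: axis ord0 + y)) ord0.
    have := coord_le_normr (z - y) ord0.
    rewrite !mxE !eqxx/= mulr1 -/d.
    move=> h1 h2 h3; have h4 := le_trans h2 zz0; have h5 := le_trans h1 h3.
    move: h4 h5; rewrite !ler_norml => /andP[h4 _] /andP[_ h5]; lra.
  rewrite /cube/=; have -> : z - y = z - ((d + 2 * t) *: axis ord0 + y) + (d + 2 * t) *: axis ord0.
    by rewrite opprD addrA addrAC subrK.
  rewrite (le_trans (ler_normD _ _))//.
  have := normr_axis (ord0 : 'I_N) (d + 2 * t).
  have dt : d <= 2 * N%:R * `|d| / `|r| * t.
    rewrite (ger0_norm d0) (gtr0_norm r0) mulrAC ler_pdivlMr//.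
    rewrite (_ : 2 * N%:R * d * t = d * (2 * N%:R * t)); last by ring.
    exact: ler_wpM2l.
  rewrite (@ger0_norm _ (d + 2 * t)) => [h|]; last by rewrite addr_ge0// mulr_ge0// ltW.
  have zz1 : `|z - ((d + 2 * t) *: axis ord0 + y)| <= c * t := zz0.
  rewrite /M /cube_distance -/d [leRHS]mulrDl; lra.
have [x0 bx0 x0y] := segment_meets_boundary oO Oy Oy'.
have [A [b [g [AA gL Og bg]]]] := chart x0 bx0.
have AtA : A^T *m A = 1%:M by exact: mulmx1C.
(* In chart coordinates, subtracting [w] lowers the height by [t] and leaves the graph variable
   fixed. *)
pose w : 'rV[R]_N := t *: axis ord0 *m A^T.
have wt : `|w| <= t.
  apply: (le_trans (normr_le_enorm _)).
  by rewrite enorm_mulmx ?trmxK// enorm_delta gtr0_norm.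
have x0z z : cube (x0 - w) (c * t) z -> `|z - x0| <= 2 * t.
  rewrite /cube/= => zz0; have -> : z - x0 = z - (x0 - w) - w by rewrite opprB addrA addrAC addrK.
  rewrite (le_trans (ler_normB _ _))//; lra.
exists (x0 - w); split => z zz0; last first.
  rewrite /cube/=; have -> : z - y = (z - x0) + (x0 - y) by rewrite addrA subrK.
  rewrite (le_trans (ler_normD _ _))//.
  have := x0z z zz0; have : 6 * t <= M * t by rewrite ler_wpM2r ?cube_distance_ge// ltW.
  move: x0y yy'; rewrite (distrC y' y); lra.
have x0r : enorm (x0 - x0) < r.
  by apply: le_lt_trans (enorm_le_normr _) _; rewrite subrr normr0 mulr0.
have zr : enorm (z - x0) < r.
  apply: le_lt_trans (enorm_le_normr _) (le_lt_trans _ tr).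
  by rewrite -mulrA mulrCA ler_wpM2l//; exact: x0z.
move=> /(Og z zr); have /(bg x0 x0r) := bx0.
pose e := (z - (x0 - w)) *m A.
have ez : z *m A + b = x0 *m A + b + (e - t *: axis ord0).
  have wA : w *m A = t *: axis ord0 by rewrite -mulmxA AtA mulmx1.
  rewrite /e !mulmxBl wA; move: (z *m A) (x0 *m A) (t *: axis ord0) => a1 a2 a3.
  by apply/rowP => j; rewrite !mxE; ring.
have een : enorm e <= N%:R * c * t.
  rewrite /e enorm_mulmx// (le_trans (enorm_le_normr _))// -mulrA ler_wpM2l//.
move=> hx0; rewrite ltNge => /negP; apply.
have hz : (z *m A + b) ord0 ord0 = (x0 *m A + b) ord0 ord0 + e ord0 ord0 - t.
  by rewrite ez !mxE eqxx mulr1 !addrA.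
have tz : col' ord0 (z *m A + b) - col' ord0 (x0 *m A + b) = col' ord0 e.
  rewrite ez; apply/rowP => j; rewrite !mxE/= addrAC subrr add0r.
  by rewrite mulr0 subr0.
have gz := gL (col' ord0 (z *m A + b)) (col' ord0 (x0 *m A + b)).
rewrite tz in gz.
have gz2 := le_trans gz (ler_wpM2l L0 (le_trans (enorm_col'_le _) een)).
have e0 : e ord0 ord0 <= N%:R * c * t.
  apply: le_trans een; apply: le_trans (ler_norm _) _.
  exact: le_trans (coord_le_normr _ _) (normr_le_enorm _).
rewrite hz hx0; move: gz2; rewrite ler_norml => /andP[gz2 _].
have : N%:R * c * t + L * (N%:R * c * t) = t.
  by transitivity (N%:R * c * (1 + L) * t); [ring|rewrite cN mul1r].
move: gz2 e0; set a := N%:R * c * t; set b' := L * a; lra.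
Qed.

End exterior_geometry.

(** * Translations in L^p controlled by the gradient *)

Section line_derivative.
Context {R : realType}.

Lemma line_is_derive (V : normedModType R) (f : V -> R) (v x : V) (s d : R) :
  is_derive (s *: v + x) v f d -> is_derive s 1 (fun s : R => f (s *: v + x)) d.
Proof.
move=> [df <-].
have E : (fun h : R => h^-1 *: (f ((h *: 1 + s) *: v + x) - f (s *: v + x))) =
    (fun h : R => h^-1 *: (f (h *: v + (s *: v + x)) - f (s *: v + x))).
  by apply/funext => h; rewrite scalerDl addrA /GRing.scale/= mulr1.
by split; rewrite /derivable /derive/= E.
Qed.

End line_derivative.

Section Lp_translation.
Context {R : realType} {n : nat}.
Local Notation N := n.+1.
Local Notation mu := (lebesgue_rV N).
Local Notation leb := (@lebesgue_measure R).
Variables (p : R) (v : 'rV[R]_N -> R).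
Hypotheses (p1 : 1 < p) (sv : smooth v).
Local Open Scope ereal_scope.

Let p0 : (0 < p)%R. Proof. by move: p1; lra. Qed.

Let cv : continuous v. Proof. exact: smooth_continuous. Qed.

Let mv : measurable_fun setT v. Proof. exact: continuous_measurable_rV. Qed.

Let mp j : measurable_fun setT (partial j v).
Proof. by apply: continuous_measurable_rV; exact: smooth_partial_continuous. Qed.

Let line_continuous (f : 'rV[R]_N -> R) (e x : 'rV[R]_N) :
  continuous f -> continuous (fun s : R => f (s *: e + x)%R).
Proof.
move=> cf; have H := @continuous_line R _ x e.
rewrite (_ : (fun s : R => _) = f \o (fun s => x + s *: e)%R); last first.
  by apply/funext => s; rewrite /= addrC.
by move=> s; apply: continuous_comp; [exact: H|exact: cf].
Qed.

Lemma axis_FTC j (s : R) x : (0 < s)%R ->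
  \int[leb]_(r in `[0%R, s]) (partial j v (r *: axis j + x))%:E =
  (v (s *: axis j + x) - v x)%:E.
Proof.
move=> s0; pose F (r : R) : R := v (r *: axis j + x)%R.
have dF (r : R) : is_derive r 1%R F (partial j v (r *: axis j + x)%R).
  by apply: line_is_derive; exact: smooth_is_derive.
have cF : continuous F by exact: line_continuous.
rewrite (@continuous_FTC2 _ _ F 0%R s s0).
- by rewrite /F scale0r add0r EFinB.
- apply: continuous_subspaceT; apply: line_continuous; exact: smooth_partial_continuous.
- split.
  + by move=> r _; have H := dF r; exact: ex_derive.
  + by apply: cvg_at_right_filter; exact: cF.
  + by apply: cvg_at_left_filter; exact: cF.
- by move=> r _; have H := dF r; rewrite derive1E; exact: derive_val.
Qed.

Lemma axis_increment_powR j (s : R) x : (0 < s)%R ->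
  (`|v (s *: axis j + x) - v x| `^ p)%:E <=
  (s `^ (p - 1))%:E *
  \int[leb]_(r in `[0%R, s]) (`|partial j v (r *: axis j + x)| `^ p)%:E.
Proof.
move=> s0.
have mf : measurable_fun (setT : set (measurableTypeR R))
    (fun r => partial j v (r *: axis j + x)%R).
  apply: continuous_measurable_fun; apply: line_continuous.
  exact: smooth_partial_continuous.
have lebs : leb `[0%R, s]%classic = s%:E.
  by rewrite lebesgue_measure_itv/= lte_fin s0 -EFinB subr0.
have H := @jensen_powR _ _ R leb `[0%R, s]%classic s p
  (fun r => `|partial j v (r *: axis j + x)|%R) p1 (measurable_itv _) lebs _ _.
apply: le_trans (H _ _); last 2 first.
- by apply: measurableT_comp.
- by [].
rewrite -poweR_EFin; apply: lee_poweR; [exact: ltW|by rewrite lee_fin|].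
have -> : `|v (s *: axis j + x) - v x|%:E =
    `| \int[leb]_(r in `[0%R, s]) (partial j v (r *: axis j + x))%:E |.
  by rewrite axis_FTC.
by apply: le_abse_integral => //; apply: measurable_funTS; exact/measurable_EFinP.
Qed.

(** The fundamental theorem of calculus and Jensen on the segment cost [s^(p-1)]. After Tonelli the
    integral over [x] is the same for each [r] by translation invariance, so integrating over [r]
    gives the last factor [s]. *)
Lemma axis_translation_pos j (s : R) : (0 < s)%R ->
  \int[mu]_x (`|v (s *: axis j + x) - v x| `^ p)%:E <=
  (s `^ p)%:E * \int[mu]_x (`|partial j v x| `^ p)%:E.
Proof.
move=> s0.
pose G (z : 'rV[R]_N * measurableTypeR R) : \bar R :=
  (`|partial j v (z.2 *: axis j + z.1)| `^ p)%:E.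
have mG : measurable_fun setT G.
  apply/measurable_EFinP; apply: (measurableT_comp (measurable_powR _)).
  apply: measurableT_comp => //; apply: (measurableT_comp (mp j)).
  by apply: measurable_fun_rVD => //; exact: measurable_fun_rVZ.
pose I := \int[mu]_x (`|partial j v x| `^ p)%:E.
pose S : set (measurableTypeR R) := `[0%R, s]%classic.
have mS : measurable S by exact: measurable_itv.
pose GS := G \_ (snd @^-1` S).
have mGS : measurable_fun setT GS.
  apply/measurable_restrict => //; last exact: measurable_funTS.
  by rewrite -[X in measurable X]setTI; exact: measurable_snd.
have GS0 z : 0 <= GS z by apply: erestrict_ge0 => y _; rewrite lee_fin powR_ge0.
have GSE x r : GS (x, r) = ((fun r => G (x, r)) \_ S) r.
  by rewrite /GS !patchE; congr (if _ then _ else _); apply/idP/idP; rewrite !inE.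
apply: (@le_trans _ _ (\int[mu]_x ((s `^ (p - 1))%:E * \int[leb]_r GS (x, r)))).
  apply: ge0_le_integral_nomeas => x _; first by rewrite lee_fin powR_ge0.
  apply: le_trans (axis_increment_powR j x s0) _.
  rewrite lee_wpmul2l ?lee_fin ?powR_ge0// integral_mkcond.
  by under [leRHS]eq_integral do rewrite GSE.
rewrite ge0_integralZl//; last 3 first.
- exact: (@measurable_fun_fubini_tonelli_F _ _ _ _ R leb GS).
- by move=> x _; exact: integral_ge0.
- by rewrite lee_fin powR_ge0.
rewrite (fubini_tonelli GS mGS GS0).
have -> : \int[leb]_r \int[mu]_x GS (x, r) = \int[leb]_(r in S) (cst I) r.
  rewrite [RHS]integral_mkcond; apply: eq_integral => r _.
  rewrite patchE; case: ifPn => rS.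
    rewrite /= /I -(@integral_rV_translation _ _
      (fun x => (`|partial j v x| `^ p)%:E) (r *: axis j)).
    + by apply: eq_integral => x _; rewrite GSE patchE rS /G/= addrC.
    + apply/measurable_EFinP; apply: (measurableT_comp (measurable_powR _)).
      exact: measurableT_comp.
    + by move=> x; rewrite lee_fin powR_ge0.
  by rewrite integral0_eq// => x _; rewrite GSE patchE (negbTE rS).
rewrite integral_cst//.
rewrite [X in _ * (_ * X)](_ : _ = s%:E); last first.
  by apply: (etrans (lebesgue_measure_itv _)); rewrite /= lte_fin s0 -EFinB subr0.
rewrite muleC -muleA -EFinM mulrC muleC.
by rewrite (mulrC _ s) mulr_powRB1// ltW.
Qed.

Lemma axis_translation_le j (s : R) :
  \int[mu]_x (`|v (s *: axis j + x) - v x| `^ p)%:E <=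
  (`|s| `^ p)%:E * \int[mu]_x (`|partial j v x| `^ p)%:E.
Proof.
have [s0|s0|<-] := ltgtP 0%R s.
- by rewrite gtr0_norm//; exact: axis_translation_pos.
- rewrite ltr0_norm//; have Ns0 : (0 < - s)%R by rewrite oppr_gt0.
  apply: le_trans (axis_translation_pos j Ns0).
  (* Translating [x] by [- s] along the axis turns the increment of step [s] into minus the
     increment of step [- s], which is the positive case. *)
  rewrite -(@integral_rV_translation _ _
    (fun x => (`|v (s *: axis j + x) - v x| `^ p)%:E) (- s *: axis j)).
  + apply: ge0_le_integral_nomeas => x _; first by rewrite lee_fin powR_ge0.
    have -> : (s *: axis j + (x + - s *: axis j) = x)%R.
      by rewrite scaleNr addrCA addrN addr0.
    by rewrite distrC (addrC x).
  + apply/measurable_EFinP; apply: (measurableT_comp (measurable_powR _)).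
    apply: measurableT_comp => //; apply: measurable_funB => //.
    apply: (measurableT_comp mv).
    by apply: measurable_fun_rVD => //; exact: measurable_cst.
  + by move=> x; rewrite lee_fin powR_ge0.
- rewrite integral0_eq => [|x _].
    by rewrite mule_ge0 ?lee_fin ?powR_ge0//; apply: integral_ge0 => x _; rewrite lee_fin powR_ge0.
  by rewrite scale0r add0r subrr normr0 powR0// gt_eqF.
Qed.

(** The increment is a sum of [N] axis increments taken at corners. Each corner is a fixed translate
    of [x], so translation invariance reduces each term to [axis_translation_le]. *)
Lemma translation_le (h : 'rV[R]_N) :
  \int[mu]_x (`|v (x + h) - v x| `^ p)%:E <=
  (N%:R `^ p * N%:R * `|h| `^ p)%:E * \int[mu]_x (enorm (grad v x) `^ p)%:E.
Proof.
pose a j x := (v (h ord0 j *: axis j + corner x h j) - v (corner x h j))%R.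
have ma (j : 'I_N) : measurable_fun setT (a j).
  have mc : measurable_fun setT (fun x : 'rV[R]_N => corner x h j).
    by apply: measurable_fun_rVD => //; exact: measurable_cst.
  apply: measurable_funB; last exact: measurableT_comp.
  by apply: (measurableT_comp mv); apply: measurable_fun_rVD.
have map (j : 'I_N) : measurable_fun setT (fun x => (`|a j x| `^ p)%:E).
  apply/measurable_EFinP; apply: (measurableT_comp (measurable_powR _)).
  exact: measurableT_comp.
pose I := \int[mu]_x (enorm (grad v x) `^ p)%:E.
have I0 : 0 <= I by apply: integral_ge0 => x _; rewrite lee_fin powR_ge0.
have aI (j : 'I_N) : \int[mu]_x (`|a j x| `^ p)%:E <= (`|h| `^ p)%:E * I.
  rewrite /a /corner; set w := (\row_i _)%R.
  rewrite (@integral_rV_translation _ _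
    (fun x => (`|v (h ord0 j *: axis j + x) - v x| `^ p)%:E) w); last 2 first.
  - apply/measurable_EFinP; apply: (measurableT_comp (measurable_powR _)).
    apply: measurableT_comp => //; apply: measurable_funB => //.
    apply: (measurableT_comp mv).
    by apply: measurable_fun_rVD => //; exact: measurable_cst.
  - by move=> x; rewrite lee_fin powR_ge0.
  apply: le_trans (axis_translation_le j _) _.
  apply: lee_pmul.
  - by rewrite lee_fin powR_ge0.
  - by apply: integral_ge0 => x _; rewrite lee_fin powR_ge0.
  - rewrite lee_fin; apply: ge0_ler_powR; rewrite ?nnegrE ?(ltW p0)//.
    exact: coord_le_normr.
  - apply: ge0_le_integral_nomeas => x _; first by rewrite lee_fin powR_ge0.
    rewrite lee_fin; apply: ge0_ler_powR; rewrite ?nnegrE ?(ltW p0) ?enorm_ge0//.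
    apply: le_trans (normr_le_enorm _).
    by have := coord_le_normr (grad v x) j; rewrite mxE.
apply: (@le_trans _ _ (\int[mu]_x ((N%:R `^ p)%:E * \sum_(j < N) (`|a j x| `^ p)%:E))).
  apply: ge0_le_integral_nomeas => x _; first by rewrite lee_fin powR_ge0.
  rewrite corner_telescope sumEFin -EFinM lee_fin.
  apply: le_trans (powR_sum_le p0 (fun j => normr_ge0 (a j x))).
  apply: ge0_ler_powR; rewrite ?nnegrE ?sumr_ge0 ?(ltW p0)//.
  exact: ler_norm_sum.
have mS : measurable_fun setT (fun x => \sum_(j < N) (`|a j x| `^ p)%:E).
  by apply: emeasurable_sum => j; exact: map.
rewrite ge0_integralZl//; last first.
  by move=> x _; apply: sume_ge0 => j _; rewrite lee_fin powR_ge0.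
rewrite ge0_integral_sum//.
rewrite -mulrA EFinM -muleA lee_wpmul2l ?lee_fin ?powR_ge0//.
apply: (le_trans (lee_sum _ (fun j _ => aI j))).
rewrite -ge0_sume_distrl; last by move=> j _; rewrite lee_fin powR_ge0.
by rewrite sumEFin sumr_const card_ord mulr_natl.
Qed.

End Lp_translation.

(** * Bound of the near energy by the K-functional *)

Section near_energy_K.
Context {R : realType} {n : nat}.
Local Notation N := n.+1.
Local Notation mu := (lebesgue_rV N).
Variables (Omega : set 'rV[R]_N) (p : R).
Hypothesis p1 : 1 < p.
Local Open Scope ereal_scope.

Let p0 : (0 < p)%R. Proof. by move: p1; lra. Qed.

(** The support is closed and contained in [Omega], so [v] vanishes on a whole neighbourhood of [x],
    also when [x] is on the boundary. *)
Lemma grad_out v x : C0infty Omega v -> ~ Omega x -> grad v x = 0%R.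
Proof.
move=> [sv _ vO] Ox; apply/rowP => j; rewrite !mxE /partial.
rewrite (@near_eq_derive _ _ _ _ (cst 0%R)) ?derive_cst//.
have : nbhs x (~` closure [set x | v x != 0%R]).
  apply: open_nbhs_nbhs; split; first exact/closed_openC/closed_closure.
  by move=> /vO.
apply: filterS => y Hy; apply/eqP; apply: contrapT => /negP vy; apply: Hy.
exact: subset_closure.
Qed.

Lemma Lpnorm_powR (f : 'rV[R]_N -> R) : (forall x, ~ Omega x -> f x = 0%R) ->
  Lpnorm Omega p f `^ p = \int[mu]_x (`|f x| `^ p)%:E.
Proof.
move=> fO; rewrite /Lpnorm poweR_invK ?gt_eqF//; last first.
  by apply: integral_ge0 => x _; rewrite lee_fin powR_ge0.
rewrite integral_mkcond; apply: eq_integral => x _; rewrite patchE.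
case: ifPn => //; rewrite notin_setE => /fO ->.
by rewrite normr0 powR0// gt_eqF.
Qed.

(** [3^p] comes from splitting an increment of [u] into three terms, 2 from the two copies of
    [u - v], and the last summand from [translation_le]. *)
Definition translation_const (m : nat) (p' : R) : R :=
  (3 `^ p' * (2 + m%:R `^ p' * m%:R))%R.

Lemma translation_const_gt0 m : (0 < translation_const m p)%R.
Proof.
by rewrite mulr_gt0 ?powR_gt0// ltr_pwDl// mulr_ge0// powR_ge0.
Qed.

(** For any competitor [v], [u(x+h) - u(x)] is the increment of [u - v] plus that of [v]. Both terms
    of the former have the L^p norm of [u - v], and [|h| <= t] bounds the latter by a multiple of
    [t] times the norm of the gradient. *)
Lemma translation_le_Kfunctional u (h : 'rV[R]_N) (t : R) : C0infty Omega u ->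
  (0 < t)%R -> (`|h| <= t)%R ->
  \int[mu]_x (`|u (x + h) - u x| `^ p)%:E <=
  (translation_const N p)%:E * Kfunctional Omega p t u `^ p.
Proof.
move=> uC t0 ht; set I := \int[mu]_x _; set C := translation_const N p.
have C0 : (0 < C)%R := translation_const_gt0 N.
have I0 : 0 <= I by apply: integral_ge0 => x _; rewrite lee_fin powR_ge0.
have mu_ := C0infty_measurable uC.
have mtr (f : 'rV[R]_N -> R) (w : 'rV[R]_N) : measurable_fun setT f ->
    measurable_fun setT (fun x : 'rV[R]_N => f (x + w)%R).
  move=> mf; apply: (measurableT_comp mf).
  by apply: measurable_fun_rVD => //; exact: measurable_cst.
have mpow (f : 'rV[R]_N -> R) : measurable_fun setT f ->
    measurable_fun setT (fun x => (`|f x| `^ p)%:E).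
  move=> mf; apply/measurable_EFinP; apply: (measurableT_comp (measurable_powR _)).
  exact: measurableT_comp.
have pow0 (f : 'rV[R]_N -> R) x : 0 <= (`|f x| `^ p)%:E by rewrite lee_fin powR_ge0.
(* With [C] on the left, p-th roots isolate the infimum, and the bound can be tested on one
   competitor at a time. *)
suff H : (C^-1)%:E * I <= Kfunctional Omega p t u `^ p.
  by rewrite -lee_pdivrMl.
rewrite -[leLHS](@poweR_invK _ _ p) ?gt_eqF//; last first.
  by rewrite mule_ge0// lee_fin invr_ge0 ltW.
apply: lee_poweR; [exact: ltW|exact: poweR_ge0|].
apply: le_ereal_inf_tmp => _ [v vC <-].
set al := Lpnorm _ _ _; set be := Lpnorm _ _ _.
have al0 : 0 <= al by exact: poweR_ge0.
have be0 : 0 <= be by exact: poweR_ge0.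
have tbe0 : 0 <= t%:E * be by rewrite mule_ge0// lee_fin ltW.
have y0 : 0 <= al + t%:E * be := adde_ge0 al0 tbe0.
have CI0 : 0 <= (C^-1)%:E * I by rewrite mule_ge0// lee_fin invr_ge0 ltW.
have pV0 : (0 <= p^-1)%R by rewrite invr_ge0 ltW.
rewrite -(poweRK_inv (lt0r_neq0 p0) y0); apply: (lee_poweR pV0 CI0).
rewrite lee_pdivrMl//.
have mv := C0infty_measurable vC.
pose a (x : 'rV[R]_N) := (u x - v x)%R.
have ma : measurable_fun setT a by exact: measurable_funB.
have alE : al `^ p = \int[mu]_x (`|a x| `^ p)%:E.
  apply: Lpnorm_powR => x Ox; rewrite /= (C0infty_out uC)// (C0infty_out vC)//.
  by rewrite subr0.
have beE : be `^ p = \int[mu]_x (enorm (grad v x) `^ p)%:E.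
  rewrite /be Lpnorm_powR => [|x Ox].
    by apply: eq_integral => x _; rewrite ger0_norm// enorm_ge0.
  by rewrite (grad_out vC)// /enorm big1 ?sqrtr0// => i _; rewrite mxE expr0n.
have alhE : \int[mu]_x (`|a (x + h)%R| `^ p)%:E = al `^ p.
  rewrite alE (@integral_rV_translation _ _ (fun x => (`|a x| `^ p)%:E))//.
  exact: mpow.
pose dv (x : 'rV[R]_N) := (v (x + h) - v x)%R.
have mdv : measurable_fun setT dv by apply: measurable_funB => //; exact: mtr.
apply: (@le_trans _ _ ((3 `^ p)%:E *
    (al `^ p + (al `^ p + \int[mu]_x (`|dv x| `^ p)%:E)))).
  have mA := mpow _ ma; have mD := mpow _ mdv.
  have mAh := mpow _ (mtr _ h ma); have mAD := emeasurable_funD mA mD.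
  have mAAD := emeasurable_funD mAh mAD.
  have AD0 x : 0 <= (`|a x| `^ p)%:E + (`|dv x| `^ p)%:E by rewrite adde_ge0.
  have AAD0 x : 0 <= (`|a (x + h)%R| `^ p)%:E +
    ((`|a x| `^ p)%:E + (`|dv x| `^ p)%:E) by rewrite adde_ge0.
  have p30 : 0 <= (3 `^ p)%:E by rewrite lee_fin powR_ge0.
  have E1 := ge0_integralD mu measurableT (fun x _ => pow0 a x) mA
    (fun x _ => pow0 dv x) mD.
  have E2 := ge0_integralD mu measurableT (fun x _ => pow0 (fun x => a (x + h)%R) x)
    mAh (fun x _ => AD0 x) mAD.
  have E3 := ge0_integralZl mu measurableT mAAD (fun x _ => AAD0 x) p30.
  rewrite E1 in E2; rewrite E2 alhE -alE in E3.
  rewrite -[leRHS]E3.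
  apply: ge0_le_integral_nomeas => x _; first by rewrite lee_fin powR_ge0.
  pose f (i : 'I_3) := [:: `|a (x + h)|; `|a x|; `|dv x|]`_i%R.
  have f0 i : (0 <= f i)%R by rewrite /f; case: i => -[|[|[|//]]] ? /=.
  have := powR_sum_le p0 f0; rewrite !big_ord_recl !big_ord0/= /f/= !addr0.
  rewrite -!EFinD -EFinM lee_fin; apply: le_trans.
  apply: ge0_ler_powR; rewrite ?nnegrE ?addr_ge0 ?(ltW p0)//.
  rewrite (_ : u (x + h) - u x = a (x + h) + (- a x + dv x))%R; last first.
    by rewrite /a /dv; ring.
  rewrite (le_trans (ler_normD _ _))// lerD// (le_trans (ler_normD _ _))//.
  by rewrite normrN.
set y := al + t%:E * be.
have aly : al `^ p <= y `^ p.
  exact: (lee_poweR (ltW p0) al0 (leeDl _ tbe0)).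
have dvy : \int[mu]_x (`|dv x| `^ p)%:E <= (N%:R `^ p * N%:R)%:E * y `^ p.
  apply: (le_trans (translation_le p1 (let: And3 sv _ _ := vC in sv) h)).
  rewrite -beE EFinM -muleA lee_wpmul2l ?lee_fin ?mulr_ge0 ?powR_ge0//.
  apply: (@le_trans _ _ ((t%:E * be) `^ p)).
    rewrite poweRM ?lee_fin ?(ltW t0)// poweR_EFin lee_wpmul2r ?poweR_ge0//.
    by rewrite lee_fin; apply: ge0_ler_powR; rewrite ?nnegrE ?(ltW p0) ?(ltW t0).
  exact: (lee_poweR (ltW p0) tbe0 (leeDr _ al0)).
rewrite /C /translation_const EFinM -muleA lee_wpmul2l ?lee_fin ?powR_ge0//.
have q0 : 0 <= (N%:R `^ p * N%:R)%:E :> \bar R by rewrite lee_fin mulr_ge0// powR_ge0.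
rewrite (_ : (2 + N%:R `^ p * N%:R)%:E = 1 + (1 + (N%:R `^ p * N%:R)%:E)); last first.
  by rewrite -!EFinD; congr EFin; ring.
rewrite ge0_muleDl ?adde_ge0// mul1e ge0_muleDl// mul1e.
by rewrite leeD// leeD.
Qed.

(** The substitution [y = x + h] makes the range of [h] independent of [x]. After Tonelli the
    translation bound applies for each [h] in a cube of volume [(2 t)^N]. *)
Lemma near_energy_le_Kfunctional u (t : R) : C0infty Omega u -> (0 < t)%R ->
  near_energy p u t <=
  ((2 * t) ^+ N * translation_const N p)%:E * Kfunctional Omega p t u `^ p.
Proof.
move=> uC t0; have mu_ := C0infty_measurable uC.
have mF : measurable_fun setT
    (fun z : 'rV[R]_N * 'rV[R]_N => `|u z.1 - u z.2| `^ p)%R.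
  exact: measurable_increment.
rewrite /near_energy (strip_integral1 _ mF); last by move=> z; rewrite powR_ge0.
pose G (z : 'rV[R]_N * 'rV[R]_N) := (`|u z.1 - u (z.2 + z.1)%R| `^ p)%:E.
have mG : measurable_fun setT G.
  apply/measurable_EFinP; apply: (measurableT_comp (measurable_powR _)).
  apply: measurableT_comp => //; apply: measurable_funB; first exact: measurableT_comp.
  by apply: (measurableT_comp mu_); apply: measurable_fun_rVD.
pose GS := G \_ (snd @^-1` cube 0%R t).
have mS : measurable (cube (0%R : 'rV[R]_N) t) by exact: measurable_cube.
have mGS : measurable_fun setT GS.
  apply/measurable_restrict => //; last exact: measurable_funTS.
  by rewrite -[X in measurable X]setTI; exact: measurable_snd.
have GS0 z : 0 <= GS z by apply: erestrict_ge0 => y _; rewrite lee_fin powR_ge0.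
rewrite (_ : \int[mu]_x _ = \int[mu]_x \int[mu]_h GS (x, h)); last first.
  apply: eq_integral => x _; rewrite [LHS]integral_mkcond.
  rewrite -(@integral_rV_translation _ _
    ((fun y => (`|u x - u y| `^ p)%:E) \_ (cube x t)) x).
  - apply: eq_integral => h _; rewrite /GS !patchE.
    suff -> : ((h + x)%R \in cube x t) = ((x, h) \in snd @^-1` cube 0%R t) by [].
    by apply/idP/idP; rewrite !inE /cube/= subr0 addrK.
  - apply/measurable_restrict => //; first exact: measurable_cube.
    apply: measurable_funTS; apply/measurable_EFinP.
    apply: (measurableT_comp (measurable_powR _)).
    by apply: measurableT_comp => //; apply: measurable_funB.
  - by move=> y; apply: erestrict_ge0 => z _; rewrite lee_fin powR_ge0.
rewrite (fubini_tonelli GS mGS GS0).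
set K := Kfunctional _ _ _ _; set C := translation_const N p.
apply: (@le_trans _ _ (\int[mu]_(h in cube 0%R t) (cst (C%:E * K `^ p)) h)).
  rewrite [leRHS]integral_mkcond; apply: ge0_le_integral_nomeas => h _.
    exact: integral_ge0.
  rewrite patchE; case: ifPn => hS.
    have ht : (`|h| <= t)%R by move: hS; rewrite inE /cube/= subr0.
    apply: le_trans (translation_le_Kfunctional uC t0 ht).
    apply: ge0_le_integral_nomeas => x _; first exact: GS0.
    rewrite /GS patchE; case: ifPn => _; last by rewrite lee_fin powR_ge0.
    by rewrite /G/= distrC (addrC h).
  rewrite integral0_eq// => x _; rewrite /GS patchE ifF//.
  by apply/negbTE; move: hS; rewrite !notin_setE.
rewrite integral_cst//; have t00 := ltW t0.
by rewrite [X in _ * X](lebesgue_rV_cube 0%R t00) muleC muleA -EFinM.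
Qed.

End near_energy_K.

(* For [m1 \x m2] the library infers this structure only when [m1] and [m2] are
   subprobabilities: that later instance shadows the general one. *)
Definition product_sigma_finite d1 d2 (T1 : measurableType d1)
    (T2 : measurableType d2) (R : realType)
    (m1 : {sigma_finite_measure set T1 -> \bar R})
    (m2 : {sigma_finite_measure set T2 -> \bar R}) :
    {sigma_finite_measure set (T1 * T2)%type -> \bar R} :=
  HB.pack (m1 \x m2)%E
    (lebesgue_integral_fubini.measure_function_Measure_isSigmaFinite__to__measure_function_isSigmaFinite m1 m2)
    (lebesgue_integral_fubini.measure_function_Measure_isSigmaFinite__to__measure_function_isSFinite m1 m2).

Lemma le_scaled_integral d (T : measurableType d) (R : realType)
    (mu : {measure set T -> \bar R}) (f g : T -> R) (a b : R) : 0 <= a -> 0 <= b ->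
  measurable_fun setT f -> measurable_fun setT g ->
  (forall x, 0 <= f x) -> (forall x, 0 <= g x) -> (forall x, a * f x <= b * g x) ->
  (a%:E * \int[mu]_x (f x)%:E <= b%:E * \int[mu]_x (g x)%:E)%E.
Proof.
move=> a0 b0 mf mg f0 g0 fg.
have mfE : measurable_fun setT (fun x => (f x)%:E) by exact/measurable_EFinP.
have mgE : measurable_fun setT (fun x => (g x)%:E) by exact/measurable_EFinP.
have f0E x : setT x -> (0 <= (f x)%:E)%E by rewrite lee_fin.
have g0E x : setT x -> (0 <= (g x)%:E)%E by rewrite lee_fin.
have a0E : (0 <= a%:E)%E by rewrite lee_fin.
have b0E : (0 <= b%:E)%E by rewrite lee_fin.
rewrite -(ge0_integralZl mu measurableT mfE f0E a0E).
rewrite -(ge0_integralZl mu measurableT mgE g0E b0E).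
by apply: ge0_le_integral_nomeas => x _; rewrite -?EFinM lee_fin// mulr_ge0.
Qed.

(** * From bounds at each scale to the two norms *)

Section norm_comparison.
Context {R : realType} {n : nat}.
Local Notation N := n.+1.
Local Notation mu := (lebesgue_rV N).
Variables (Omega : set 'rV[R]_N) (p s : R) (u : 'rV[R]_N -> R).
Hypotheses (p1 : 1 < p) (s01 : 0 < s < 1) (uC : C0infty Omega u).
Local Open Scope ereal_scope.

Let p0 : (0 < p)%R. Proof. by move: p1; lra. Qed.

Let s0 : (0 < s)%R. Proof. by case/andP: s01. Qed.

Let b := (N%:R + s * p)%R.

Let N1 : (1 <= N%:R :> R)%R. Proof. by rewrite ler1n. Qed.

Let sp0 : (0 < s * p)%R. Proof. exact: mulr_gt0. Qed.

Let b1 : (1 <= b)%R. Proof. by rewrite /b; move: N1 sp0; lra. Qed.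

Let b0 : (0 < b)%R. Proof. by move: b1; lra. Qed.

(** Together with [b1], this removes [s] from the constant of [Xnorm_le_Dnorm]. *)
Let bp : (b <= N%:R + p)%R.
Proof. by rewrite lerD2l ler_piMl ?(ltW p0)//; case/andP: s01 => _ /ltW. Qed.

Let F (z : 'rV[R]_N * 'rV[R]_N) : R := (`|u z.1 - u z.2| `^ p)%R.

Let w (z : 'rV[R]_N * 'rV[R]_N) : R := `|z.1 - z.2|%R.

Let D : \bar R := \int[mu \x mu]_z (F z / enorm (z.1 - z.2) `^ b)%:E.

Let mu_ : measurable_fun setT u. Proof. exact: C0infty_measurable uC. Qed.

Let mF : measurable_fun setT F. Proof. exact: measurable_increment. Qed.

Let mw : measurable_fun setT w. Proof. exact: measurable_distance. Qed.

Let F0 z : (0 <= F z)%R. Proof. exact: powR_ge0. Qed.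

Let w0 z : (0 <= w z)%R. Proof. exact: normr_ge0. Qed.

Let wF z : w z = 0%R -> F z = 0%R.
Proof.
move=> /normr0_eq0/subr0_eq wz.
by rewrite /F wz subrr normr0 powR0// gt_eqF.
Qed.

Let mDint : measurable_fun setT
  (fun z : 'rV[R]_N * 'rV[R]_N => F z / enorm (z.1 - z.2) `^ b)%R.
Proof.
apply: measurable_funM => //.
rewrite (_ : (fun _ => _) = (fun z : 'rV[R]_N * 'rV[R]_N =>
  enorm (z.1 - z.2) `^ (- b))%R); last by apply/funext => z; rewrite powRN.
apply: (measurableT_comp (measurable_powR _)).
by apply: (measurableT_comp (@measurable_enorm R N)); exact: measurable_fun_rVB.
Qed.

Let Dint0 (z : 'rV[R]_N * 'rV[R]_N) : (0 <= F z / enorm (z.1 - z.2) `^ b)%R.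
Proof. by rewrite divr_ge0// powR_ge0. Qed.

Let D0 : 0 <= D. Proof. by apply: integral_ge0 => z _; rewrite lee_fin. Qed.

Let mwb (C : R) : measurable_fun setT (fun z => C * F z / w z `^ b)%R.
Proof.
apply: measurable_funM; first exact: measurable_funM.
rewrite (_ : (fun _ => _) = (fun z => w z `^ (- b))%R).
  by apply: (measurableT_comp (measurable_powR _)).
by apply/funext => z; rewrite powRN.
Qed.

Let wb0 (C : R) z : (0 <= C)%R -> (0 <= C * F z / w z `^ b)%R.
Proof. by move=> C0; rewrite divr_ge0 ?mulr_ge0 ?powR_ge0. Qed.

Lemma DnormE : Dnorm s p u `^ p = D.
Proof. by apply: poweR_invK; [by rewrite gt_eqF|exact: D0]. Qed.

Let K t := Kfunctional Omega p t u.

Lemma XnormE : Xnorm Omega s p u `^ p =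
  \int[lebesgue_measure]_(t in `]0%R, +oo[) ((t `^ (- (s * p) - 1))%:E * K t `^ p).
Proof.
have E t : (0 < t)%R -> (K t * (t `^ s)^-1%:E) `^ p * t^-1%:E =
    (t `^ (- (s * p) - 1))%:E * K t `^ p.
  move=> t0; rewrite poweRM ?Kfunctional_ge0 ?(ltW t0)//; last first.
    by rewrite lee_fin invr_ge0 powR_ge0.
  rewrite -muleA muleC poweR_EFin -EFinM; congr (_%:E * _).
  rewrite -powRN -powRrM mulNr -(powR_inv1 (ltW t0)) -powRD//.
  by apply/implyP => _; rewrite gt_eqF.
rewrite /Xnorm poweR_invK ?gt_eqF//; last first.
  apply: integral_ge0 => t /=; rewrite in_itv/= andbT => t0.
  by rewrite -/(K t) E// mule_ge0 ?lee_fin ?powR_ge0// poweR_ge0.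
by apply: eq_integral => t /[1!inE]/=; rewrite in_itv/= andbT => /E.
Qed.

Let strip_scale (C M t : R) : (0 <= C)%R ->
  \int[mu \x mu]_(z in [set z | (w z <= M * t)%R]) (C * F z)%:E =
  C%:E * near_energy p u (M * t).
Proof.
move=> C0; rewrite /near_energy -ge0_integralZl//.
- exact: measurable_strip.
- by apply: measurable_funTS; exact/measurable_EFinP.
Qed.

(** The factor [t^(-N)] in the bound on [K] turns the weight [t^(-sp-1)] into [t^(-b-1)], the one of
    the layer-cake formula. The latter yields the sup norm, and replacing it by the Euclidean norm
    costs [N^b]. *)
Lemma Xnorm_le_Dnorm (C M : R) : (0 < C)%R -> (2 <= M)%R ->
  (forall t, (0 < t)%R -> K t `^ p <= (C / t ^+ N)%:E * near_energy p u (M * t)) ->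
  Xnorm Omega s p u `^ p <= (C * (M * N%:R) `^ (N%:R + p))%:E * Dnorm s p u `^ p.
Proof.
move=> C0 M2 HK; have M0 : (0 < M)%R by move: M2; lra.
rewrite XnormE DnormE.
have mCF : measurable_fun setT (fun z => C * F z)%R by exact: measurable_funM.
have CF0 z : (0 <= C * F z)%R by rewrite mulr_ge0// ltW.
have wCF z : w z = 0%R -> (C * F z = 0)%R by move=> /wF ->; rewrite mulr0.
have LC := layer_cake (product_sigma_finite mu mu) mCF mw CF0 w0 wCF b0 M0.
apply: (@le_trans _ _ (\int[lebesgue_measure]_(t in `]0%R, +oo[)
    ((t `^ (- b - 1))%:E *
     \int[mu \x mu]_(z in [set z | (w z <= M * t)%R]) (C * F z)%:E))).
  apply: ge0_le_integral_nomeas => t /=; rewrite in_itv/= andbT => t0.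
    by rewrite mule_ge0 ?lee_fin ?powR_ge0// poweR_ge0.
  rewrite strip_scale ?(ltW C0)//.
  apply: (@le_trans _ _ ((t `^ (- (s * p) - 1))%:E *
      ((C / t ^+ N)%:E * near_energy p u (M * t)))).
    by rewrite lee_wpmul2l ?lee_fin ?powR_ge0// HK.
  rewrite !muleA -!EFinM (_ : t `^ (- (s * p) - 1) * (C / t ^+ N) =
    t `^ (- b - 1) * C)%R// mulrCA mulrC; congr (_ * _)%R.
  rewrite -(powR_mulrn _ (ltW t0)) -powRN -powRD; last first.
    by apply/implyP => _; rewrite gt_eqF.
  by congr (_ `^ _)%R; rewrite /b; ring.
rewrite LC; have Mb0 : (0 <= M `^ b / b)%R by rewrite divr_ge0 ?powR_ge0// ltW.
have CM0 : (0 <= C * (M * N%:R) `^ (N%:R + p))%R by rewrite mulr_ge0 ?powR_ge0// ltW.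
apply: (le_scaled_integral (mu \x mu) Mb0 CM0 (mwb C) mDint _ Dint0) => z.
  by apply: wb0; exact: ltW.
have [wz|wz] := eqVneq (w z) 0%R; first by rewrite (wF wz) mulr0 !mul0r !mulr0.
have wz0 : (0 < w z)%R by rewrite lt_neqAle eq_sym wz w0.
have ez0 : (0 < enorm (z.1 - z.2))%R by apply: lt_le_trans wz0 (normr_le_enorm _).
have Mb : (M `^ b / b <= M `^ b)%R.
  by rewrite ler_pdivrMr// ler_peMr ?powR_ge0.
have eb : ((w z `^ b)^-1 <= N%:R `^ b * (enorm (z.1 - z.2) `^ b)^-1)%R.
  rewrite ler_pdivlMr ?powR_gt0// mulrC ler_pdivrMr ?powR_gt0//.
  rewrite -powRM//; apply: ge0_ler_powR; rewrite ?nnegrE ?mulr_ge0 ?(ltW b0) ?(ltW ez0)//.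
  exact: enorm_le_normr.
(* A base at least 1 allows the exponent [b] to be raised to [N + p]. *)
have MN1 : (1 <= M * N%:R)%R by rewrite -[leLHS]mulr1 ler_pM//; move: M2; lra.
apply: (@le_trans _ _ (M `^ b * (C * F z * (N%:R `^ b * (enorm (z.1 - z.2) `^ b)^-1)))%R).
  by rewrite ler_pM ?divr_ge0 ?mulr_ge0 ?invr_ge0 ?powR_ge0 ?(ltW b0) ?(ltW C0)// ler_wpM2l.
rewrite (_ : (M `^ b * _)%R = C * (M * N%:R) `^ b *
    (F z / enorm (z.1 - z.2) `^ b))%R; last first.
  by rewrite powRM ?(ltW M0)//; ring.
rewrite ler_wpM2r ?divr_ge0 ?powR_ge0// ler_wpM2l ?(ltW C0)//.
exact: ler_powR.
Qed.

Lemma Dnorm_le_Xnorm : Dnorm s p u `^ p <=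
  (b * (2 ^+ N * translation_const N p))%:E * Xnorm Omega s p u `^ p.
Proof.
rewrite XnormE DnormE; set T := translation_const N p.
have T0 : (0 < T)%R := translation_const_gt0 p N.
(* Normalises the bound on the near energy: [C] times its constant [(2 t)^N T] is exactly [t^N],
   which restores the weight [t^(-sp-1)]. *)
pose C := ((2 ^+ N * T)^-1)%R.
have C0 : (0 < C)%R by rewrite invr_gt0 mulr_gt0// exprn_gt0.
have mCF : measurable_fun setT (fun z => C * F z)%R by exact: measurable_funM.
have CF0 z : (0 <= C * F z)%R by rewrite mulr_ge0// ltW.
have wCF z : w z = 0%R -> (C * F z = 0)%R by move=> /wF ->; rewrite mulr0.
have LC := layer_cake (product_sigma_finite mu mu) mCF mw CF0 w0 wCF b0 ltr01.
have bT0 : (0 < b * (2 ^+ N * T))%R by rewrite !mulr_gt0// exprn_gt0.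
rewrite -lee_pdivrMl//.
apply: (@le_trans _ _ (\int[lebesgue_measure]_(t in `]0%R, +oo[)
    ((t `^ (- b - 1))%:E *
     \int[mu \x mu]_(z in [set z | (w z <= 1 * t)%R]) (C * F z)%:E))); last first.
  apply: ge0_le_integral_nomeas => t /=; rewrite in_itv/= andbT => t0.
    rewrite mule_ge0 ?lee_fin ?powR_ge0//; apply: integral_ge0 => z _.
    by rewrite lee_fin.
  rewrite strip_scale ?(ltW C0)// mul1r.
  apply: (@le_trans _ _ ((t `^ (- b - 1))%:E * (C%:E *
      (((2 * t) ^+ N * T)%:E * K t `^ p)))).
    rewrite lee_wpmul2l ?lee_fin ?powR_ge0// lee_wpmul2l ?lee_fin ?(ltW C0)//.
    exact: near_energy_le_Kfunctional.
  rewrite !muleA -!EFinM (_ : t `^ (- b - 1) * C * ((2 * t) ^+ N * T) =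
    t `^ (- (s * p) - 1))%R//.
  rewrite (_ : t `^ (- (s * p) - 1) = t `^ (- b - 1) * t ^+ N)%R; last first.
    rewrite -(powR_mulrn _ (ltW t0)) -powRD; last first.
      by apply/implyP => _; rewrite gt_eqF.
    by congr (_ `^ _)%R; rewrite /b; ring.
  rewrite /C exprMn; field.
  by rewrite (gt_eqF T0) expf_neq0// pnatr_eq0.
rewrite LC; have bTV0 : (0 <= (b * (2 ^+ N * T))^-1)%R by rewrite invr_ge0 ltW.
have b10 : (0 <= 1 `^ b / b)%R by rewrite divr_ge0 ?powR_ge0// ltW.
apply: (le_scaled_integral (mu \x mu) bTV0 b10 mDint (mwb C) Dint0) => z.
  by apply: wb0; exact: ltW.
have [wz|wz] := eqVneq (w z) 0%R; first by rewrite (wF wz) mulr0 !mul0r !mulr0.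
have wz0 : (0 < w z)%R by rewrite lt_neqAle eq_sym wz w0.
have ez0 : (0 < enorm (z.1 - z.2))%R by apply: lt_le_trans wz0 (normr_le_enorm _).
rewrite powR1 (_ : 1 / b * (C * F z / w z `^ b) =
  (b * (2 ^+ N * T))^-1 * (F z / w z `^ b))%R; last first.
  by rewrite /C (invfM b) mul1r -!mulrA.
rewrite ler_wpM2l ?invr_ge0 ?(ltW bT0)// ler_wpM2l// lef_pV2 ?posrE ?powR_gt0//.
apply: ge0_ler_powR; rewrite ?nnegrE ?(ltW b0) ?(ltW ez0)//.
exact: normr_le_enorm.
Qed.

End norm_comparison.

(** * Positivity of the constants and conclusion *)

Lemma poweR_le_cancel {R : realType} (x y : \bar R) (C p : R) : 0 < p -> 0 <= C ->
  (0 <= x)%E -> (0 <= y)%E -> (x `^ p <= C%:E * y `^ p)%E ->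
  (x <= (C `^ p^-1)%:E * y)%E.
Proof.
move=> p0 C0 x0 y0 xy; have pn0 : p != 0 by rewrite gt_eqF.
rewrite -(poweRK_inv pn0 x0) -(poweRK_inv pn0 y0) -poweR_EFin -poweRM ?poweR_ge0 ?lee_fin//.
by apply: lee_poweR => //; rewrite ?invr_ge0 ?poweR_ge0// ltW.
Qed.

Lemma mollification_const_gt0 {R : realType} (m : nat) (p K c : R) :
  0 <= K -> 0 < c -> 0 < mollification_const m p K c.
Proof.
move=> K0 c0; have b0 : 0 < bump_min :> R by exact: bump_min_gt0.
have K1 : 0 < 1 + m%:R * K by rewrite ltr_pwDl// mulr_ge0.
have c1 : 0 < 1 + (2 / c) ^+ m by rewrite ltr_pwDl// exprn_ge0// divr_ge0// ltW.
have B0 : 0 < (bump_min ^+ m)^-1 :> R by rewrite invr_gt0 exprn_gt0.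
by rewrite mulr_gt0// ?mulr_gt0 ?powR_gt0// ?exprn_gt0// mulr_gt0.
Qed.

Theorem theorem4p10 (R : realType) (n : nat) (p : R) (hp : 1 < p) :
  exists C1 : R -> R -> R -> R,
    (forall d L r : R, 0 < C1 d L r) /\
    forall (s : R) (Omega : set 'rV[R]_n.+1),
      0 < s < 1 -> open Omega -> bounded_set Omega ->
      lipschitz_boundary Omega ->
      (forall L r : R, lipschitz_character Omega L r ->
        forall u : 'rV[R]_n.+1 -> R, C0infty Omega u ->
          (Xnorm Omega s p u `^ p <=
             (C1 (diam Omega) L r)%:E * Dnorm s p u `^ p)%E) /\
      equivalent_norms (C0infty Omega) (Xnorm Omega s p) (Dnorm s p).
Proof.
have [K K0 HK] := @mollifier_axis_lipschitz R.
(* Fixed before [s] and [Omega] are introduced; the absolute values in [cube_radius] and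
   [cube_distance] make it positive for arbitrary [d], [L], [r]. *)
pose C1 d L r := mollification_const n.+1 p K (cube_radius n.+1 L) *
  (cube_distance n.+1 d r * n.+1%:R) `^ (n.+1%:R + p).
have p0 : 0 < p by lra.
have M6 (d r : R) : 6 <= cube_distance n.+1 d r := cube_distance_ge n.+1 d r.
have C10 d L r : 0 < C1 d L r.
  rewrite mulr_gt0 ?mollification_const_gt0 ?cube_radius_gt0// powR_gt0// mulr_gt0//.
  by move: (M6 d r); lra.
exists C1; split => // s Omega s01 oO bO lO.
have XD L r : lipschitz_character Omega L r -> forall u, C0infty Omega u ->
    (Xnorm Omega s p u `^ p <= (C1 (diam Omega) L r)%:E * Dnorm s p u `^ p)%E.
  move=> lc u uC; apply: Xnorm_le_Dnorm => //.
  - exact/mollification_const_gt0/cube_radius_gt0.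
  - by move: (M6 (diam Omega) r); lra.
  - move=> t t0; apply: Kfunctional_le_near_energy => //.
    + exact: cube_radius_gt0.
    + by move: (M6 (diam Omega) r); lra.
    + exact: lipschitz_exterior_cubes.
split => //.
have [L [r lc]] := lipschitz_boundary_character bO lO.
have s0 : 0 < s by case/andP: s01.
pose C := C1 (diam Omega) L r; have C0 : 0 < C := C10 _ _ _.
pose C2 := (n.+1%:R + s * p) * (2 ^+ n.+1 * translation_const n.+1 p).
have C20 : 0 < C2.
  apply: mulr_gt0; first by rewrite addr_gt0 ?ltr0n ?mulr_gt0.
  by rewrite mulr_gt0 ?exprn_gt0//; exact: translation_const_gt0.
exists (C `^ p^-1)^-1, (C2 `^ p^-1); split.
- by rewrite invr_gt0 powR_gt0.
- by rewrite powR_gt0.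
move=> u uC.
have X0 : (0 <= Xnorm Omega s p u)%E by exact: poweR_ge0.
have D0 : (0 <= Dnorm s p u)%E by exact: poweR_ge0.
split.
  rewrite lee_pdivrMl ?powR_gt0//.
  exact: (poweR_le_cancel p0 (ltW (C10 _ _ _)) X0 D0 (XD L r lc u uC)).
exact: (poweR_le_cancel p0 (ltW C20) D0 X0 (Dnorm_le_Xnorm hp s01 uC)).
Qed.
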